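(* Let $f:\bar{\mathbb C}\to\bar{\mathbb C}$ be a rational map of degree at least $2$, let $(\mathcal A,\hat f,\pi)$ be an affine extension of $f$, and let $\mathcal H$ be the hyperbolic 3-lamination associated to $\mathcal A$. Then the induced action of $\hat f$ on $\mathcal H$ is properly discontinuous: for any $p,q\in\mathcal H$ there are neighborhoods $U\ni p$, $V\ni q$ such that $\hat f^n(U)\cap V\ne\emptyset$ for only finitely many $n\in\mathbb Z$. Similarly, the vertical geodesic flow on $\mathcal H$ is a proper $\mathbb R$-action: for any $p,q\in\mathcal H$ there are neighborhoods $U\ni p$, $V\ni q$ such that the set of $r\in\mathbb R$ for which the time-$r$ image of $U$ meets $V$ has compact closure in $\mathbb R$.
   Context: A (complex) affine 2-lamination is a Hausdorff space $\mathcal A$ covered by open sets with charts to products $T_i\times D_i$ ($T_i$ a topological space, $D_i\subset\mathbb C$ a domain) whose transition maps take local leaves $\{t\}\times D$ to local leaves, are homeomorphisms, and are restrictions of maps $z\mapsto az+b$ on local leaves. An affine orbifold 2-lamination is a Hausdorff space in which each point has a neighborhood which is either such a product box or the quotient of such a box by a finite leaf-preserving group preserving the affine structure. Global leaves are obtained by piecing together local leaves. Here every leaf is simply connected, and is affinely isomorphic to $\mathbb C$ or, for orbifold leaves, to a quotient of $\mathbb C$ by a finite rotation group. An affine extension of $f$ is an affine orbifold 2-lamination $\mathcal A$ whose leaves are simply connected, each being affinely isomorphic to $\mathbb C$ or, for orbifold leaves, to a quotient of $\mathbb C$ by a finite rotation group, together with a homeomorphism $\hat f:\mathcal A\to\mathcal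 A$ mapping leaves conformally isomorphically to leaves, and a map $\pi:\mathcal A\to\bar{\mathbb C}$ such that (1) $f\circ\pi=\pi\circ\hat f$, and (2) $\pi$ is continuous and its restriction to every leaf is non-constant and complex-analytic. The associated hyperbolic (orbifold) 3-lamination is $\mathcal H=\{\phi:\mathbb C\to\mathcal A\}/S^1$, where $\phi$ ranges over affine isomorphisms from $\mathbb C$ onto leaves of $\mathcal A$ (for orbifold leaves: the finite affine coverings $\mathbb C\to L$), and $S^1$ acts by precomposition with rotations $z\mapsto\lambda z$, $|\lambda|=1$; the class is $[\phi]$. For each leaf $L$ and fixed chart $\phi_0:\mathbb C\to L$, the map $[\phi_0\circ A]\mapsto(A(0),|A'|)$, $A$ complex affine, identifies the leaf over $L$ with $\mathbb H^3=\mathbb C\times(0,\infty)$ (or a quotient of it by the finite rotation group). The topology and lamination structure are the product ones over affine boxes of $\mathcal A$, with coordinates (transversal parameter, $(A(0),|A'|)$) taken with respect to transversally continuous affine charts (with the finite quotient for orbifold boxes). The induced action is $\hat f:[\phi]\mapsto[\hat f\circ\phi]$. The vertical geodesic flow is the $\mathbb R$-action whose time-$r$ map is $[\phi]\mapsto[\phi\circ e^r]$, where $e^r$ denotes $z\mapsto e^rz$. *)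

(* Defs.v *)
From HB Require Import structures.
From Stdlib Require Import Relation_Operators.
From mathcomp Require Import all_boot all_order all_algebra all_fingroup.
From mathcomp Require Import complex.
From mathcomp Require Import all_classical all_reals all_analysis.

Set Implicit Arguments.
Unset Strict Implicit.
Unset Printing Implicit Defensive.

Import Order.TTheory GRing.Theory Num.Theory.
Import numFieldNormedType.Exports.

Local Open Scope classical_set_scope.
Local Open Scope complex_scope.
Local Open Scope ring_scope.

(* Going through numClosedFieldType gives the complex numbers the normed
   topology of numFieldNormedType; the bare type R[i] carries none. *)
Definition Cplx (R : realType) : numClosedFieldType := R[i].

Definition sphere (R : realType) : topologicalType :=
  one_point_compactification (Cplx R).

Section RationalMaps.
Variable R : realType.
Local Notation C := (Cplx R).

Definition finite_coord (x : sphere R) : C := if x is Some z then z else 0.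

Definition infinity_coord (x : sphere R) : C := if x is Some z then z^-1 else 0.

(* The value at a point of the plane or at infinity of the map given by a
   fraction p / q in lowest terms; d is the degree of the map, so p`_d and q`_d
   are the leading coefficients of the homogenized numerator and denominator. *)
Definition rational_fun (p q : {poly C}) (x : sphere R) : sphere R :=
  let d := (maxn (size p) (size q)).-1 in
  let quo (a b : C) : sphere R := if b == 0 then None else Some (a / b) in
  if x is Some z then quo p.[z] q.[z] else quo p`_d q`_d.

Definition rational_map (d : nat) (f : sphere R -> sphere R) : Prop :=
  exists p q : {poly C},
    [/\ coprimep p q, maxn (size p) (size q) = d.+1 & f = rational_fun p q].

(* Complex differentiability at z of a map to the sphere, read in the
   coordinate w, or 1 / w when the value is infinity. *)
Definition sphere_derivable (g : C -> sphere R) (z : C) : Prop :=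
  {for z, continuous g} /\
  if g z is Some _ then derivable (finite_coord \o g) z 1
  else derivable (infinity_coord \o g) z 1.

End RationalMaps.

Section Laminations.
Variable R : realType.
Local Notation C := (Cplx R).

(* The quotient of T x D by a finite group of homeomorphisms permuting the local
   leaves {t} x D and affine on each of them, identified with an open subset of
   A by box_chart: the last three fields say that box_chart induces a
   homeomorphism from the orbit space onto its open image. Product boxes are
   the boxes with trivial group. box_act and box_chart are only meaningful on
   T x D. *)
Record orbifold_box (A : topologicalType) := OrbifoldBox {
  box_trans : topologicalType;
  box_dom : set C;
  box_group : finGroupType;
  box_act : box_group -> box_trans * C -> box_trans * C;
  box_chart : box_trans * C -> A;
  box_domain : [/\ open box_dom, connected box_dom & box_dom !=set0];
  box_act_stable : forall g x, box_dom x.2 -> box_dom (box_act g x).2;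
  box_act1 : forall x, box_dom x.2 -> box_act 1%g x = x;
  box_actM : forall g h x, box_dom x.2 ->
    box_act (g * h)%g x = box_act g (box_act h x);
  box_act_continuous : forall g,
    {within setT `*` box_dom, continuous (box_act g)};
  box_act_affine : forall g t, exists s (a b : C),
    a != 0 /\ forall z, box_dom z -> box_act g (t, z) = (s, a * z + b);
  box_chart_continuous : {within setT `*` box_dom, continuous box_chart};
  box_chart_open : forall U : set (box_trans * C),
    open U -> U `<=` setT `*` box_dom -> open (box_chart @` U);
  box_chart_fiber : forall x y, box_dom x.2 -> box_dom y.2 ->
    box_chart x = box_chart y <-> exists g, y = box_act g x }.

Arguments box_chart {A} o _.
Arguments box_act {A} o _ _.

(* Compatibility: transition maps send local leaves to local leaves and are
   affine there. For product boxes they are automatically homeomorphisms; for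
   quotient boxes the condition is on local lifts. *)
Record affine_orbifold_lamination := AffineOrbifoldLamination {
  lam_space :> topologicalType;
  lam_hausdorff : hausdorff_space lam_space;
  lam_index : Type;
  lam_box : lam_index -> orbifold_box lam_space;
  lam_cover : forall x : lam_space, exists i t z,
    box_dom (lam_box i) z /\ box_chart (lam_box i) (t, z) = x;
  lam_compat : forall i j t z s w,
    box_dom (lam_box i) z -> box_dom (lam_box j) w ->
    box_chart (lam_box i) (t, z) = box_chart (lam_box j) (s, w) ->
    exists a : C, a != 0 /\
      \forall u \near (0 : C), box_chart (lam_box i) (t, z + u) =
                               box_chart (lam_box j) (s, w + a * u) }.

Arguments lam_box : clear implicits.

Variable A : affine_orbifold_lamination.

Definition same_plaque (x y : A) : Prop := exists i t z w,
  [/\ box_dom (lam_box A i) z, box_dom (lam_box A i) w,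
      box_chart (lam_box A i) (t, z) = x &
      box_chart (lam_box A i) (t, w) = y].

Definition leaf (x : A) : set A := clos_refl_trans _ same_plaque x.

(* Near c, phi is the composition of u |-> z + a * (u - c) with the local leaf
   {t} x D of the box i. *)
Definition affine_germ (phi : C -> A) (c : C) i (t : box_trans (lam_box A i))
    (z a : C) : Prop :=
  [/\ box_dom (lam_box A i) z, a != 0 &
      \forall u \near (0 : C),
        phi (c + u) = box_chart (lam_box A i) (t, z + a * u)].

(* Affine isomorphisms from the plane onto a leaf (n = 1), and finite affine
   coverings of an orbifold leaf: phi identifies the leaf with the quotient of
   the plane by the rotations of order dividing n about some centre c. *)
Definition leaf_chart (phi : C -> A) : Prop :=
  [/\ range phi = leaf (phi 0),
      forall c, exists i t z a, affine_germ phi c (i := i) t z a &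
      exists (c : C) (n : nat), (0 < n)%N /\
        forall z w, phi z = phi w <->
          exists zeta : C, zeta ^+ n = 1 /\ w - c = zeta * (z - c)].

Definition rot_class (phi : C -> A) : set (C -> A) :=
  [set phi \o *%R lambda | lambda in [set lambda : C | `|lambda| = 1]].

Definition hyp3 : Type :=
  {X : set (C -> A) | exists2 phi, leaf_chart phi & X = rot_class phi}.

HB.instance Definition _ := gen_eqMixin hyp3.
HB.instance Definition _ := gen_choiceMixin hyp3.

(* p is the class of phi_0 \o M, where phi_0 is the affine chart of the local
   leaf {t} x D of the box i, M is affine, and x = (t, (M(0), |M'|)). *)
Definition hyp3_coord (i : lam_index A) (p : hyp3)
    (x : box_trans (lam_box A i) * (C * R)) : Prop :=
  exists2 phi, sval p phi &
    exists a : C, `|a| = x.2.2%:C /\ affine_germ phi 0 x.1 x.2.1 a.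

(* The topology glued from the product topologies of the
   T x (D x (0, +oo)), modulo the box groups. *)
Definition hyp3_open (U : set hyp3) : Prop :=
  forall i x p, hyp3_coord (i := i) p x -> U p ->
    \forall y \near x, forall q, hyp3_coord q y -> U q.

Fact hyp3_openT : hyp3_open setT.
Proof. by move=> i x p _ _; apply: filterE. Qed.

Fact hyp3_openI : setI_closed hyp3_open.
Proof.
move=> U V oU oV i x p px [Up Vp].
have := oU _ _ _ px Up; have := oV _ _ _ px Vp.
by apply: filterS2 => y hV hU q qy; split; [exact: hU | exact: hV].
Qed.

Fact hyp3_open_bigU (I : Type) (U : I -> set hyp3) :
  (forall j, hyp3_open (U j)) -> hyp3_open (\bigcup_j U j).
Proof.
move=> oU i x p px [j _ Up]; have := oU j _ _ _ px Up.
by apply: filterS => y hU q qy; exists j => //; exact: hU.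
Qed.

HB.instance Definition _ :=
  isOpenTopological.Build hyp3 hyp3_openT hyp3_openI hyp3_open_bigU.

Section Flow.

Let mul_near (P : set C) (k : C) :
  (\forall u \near (0 : C), P u) -> \forall u \near (0 : C), P (k * u).
Proof.
move=> nP; have := @mulrl_continuous C k 0.
by rewrite /continuous_at mulr0; apply.
Qed.

Lemma leaf_chart_scale (phi : C -> A) (k : C) :
  k != 0 -> leaf_chart phi -> leaf_chart (phi \o *%R k).
Proof.
move=> k0 [rphi aphi [c [n [n0 fib]]]]; split.
- rewrite /= mulr0 -rphi; apply/seteqP; split=> _ [z _ <-] /=.
    by exists (k * z).
  by exists (k^-1 * z) => //=; rewrite mulVKf.
- move=> d; have [i [t [z [a [Dz a0 near_a]]]]] := aphi (k * d).
  exists i, t, z, (a * k); split=> //; first by rewrite mulf_neq0.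
  apply: filterS (mul_near k near_a) => u /= e.
  by rewrite mulrDr e mulrA.
- exists (k^-1 * c), n; split=> // z w.
  rewrite /= fib; split=> -[zeta [zn e]]; exists zeta; split=> //.
    apply: (mulfI k0); rewrite mulrBr mulVKf // e mulrCA.
    by rewrite [in RHS]mulrBr mulVKf.
  have := congr1 ( *%R k) e; rewrite mulrBr mulVKf // => ->.
  by rewrite mulrCA [in LHS]mulrBr mulVKf.
Qed.

Let expC_neq0 (r : R) : (expR r)%:C != 0 :> C.
Proof. by rewrite fmorph_eq0 gt_eqF // expR_gt0. Qed.

Fact vertical_flow_subproof (r : R) (p : hyp3) :
  exists2 phi, leaf_chart phi &
    [set psi \o *%R ((expR r)%:C : C) | psi in sval p] = rot_class phi.
Proof.
case: p => X /= [phi lphi ->]; exists (phi \o *%R ((expR r)%:C : C)).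
  exact: leaf_chart_scale (expC_neq0 r) lphi.
apply/seteqP; split=> psi /=.
  case=> _ [lam lam1 <-] <-; exists lam => //.
  by apply/funext => u /=; rewrite mulrCA.
case=> lam lam1 <-; exists (phi \o *%R lam); first by exists lam.
by apply/funext => u /=; rewrite mulrCA.
Qed.

Definition vertical_flow (r : R) (p : hyp3) : hyp3 :=
  exist _ _ (vertical_flow_subproof r p).

End Flow.

End Laminations.

Arguments box_chart {R A} o _.
Arguments box_act {R A} o _ _.
Arguments lam_box {R} a i.

Section Extensions.
Variable R : realType.
Local Notation C := (Cplx R).

(* Leaves affinely isomorphic to C or to C / (finite rotation group) are in
   particular simply connected. ext_leaf and ext_conformal say that ext_map
   takes leaves to leaves, by maps which are holomorphic with nonzero derivative
   in (orbifold) box charts; ext_leaf_analytic is likewise read in box charts. *)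
Record affine_extension (f : sphere R -> sphere R) := AffineExtension {
  ext_lam :> affine_orbifold_lamination R;
  ext_leaves : forall x : ext_lam, exists2 phi, leaf_chart phi &
    range phi = leaf x;
  ext_map : ext_lam -> ext_lam;
  ext_inv : ext_lam -> ext_lam;
  ext_mapK : cancel ext_map ext_inv;
  ext_invK : cancel ext_inv ext_map;
  ext_map_continuous : continuous ext_map;
  ext_inv_continuous : continuous ext_inv;
  ext_leaf : forall x, ext_map @` leaf x = leaf (ext_map x);
  ext_conformal : forall i j t z s w,
    box_dom (lam_box ext_lam i) z -> box_dom (lam_box ext_lam j) w ->
    ext_map (box_chart (lam_box ext_lam i) (t, z)) =
      box_chart (lam_box ext_lam j) (s, w) ->
    exists h : C -> C, h z = w /\
      \forall z' \near z,
        [/\ derivable h z' 1, 'D_1 h z' != 0 &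
            ext_map (box_chart (lam_box ext_lam i) (t, z')) =
              box_chart (lam_box ext_lam j) (s, h z')];
  ext_proj : ext_lam -> sphere R;
  ext_semiconj : f \o ext_proj = ext_proj \o ext_map;
  ext_proj_continuous : continuous ext_proj;
  ext_leaf_nonconstant : forall x, exists2 y, leaf x y &
    ext_proj y <> ext_proj x;
  ext_leaf_analytic : forall i t z, box_dom (lam_box ext_lam i) z ->
    sphere_derivable
      (fun w => ext_proj (box_chart (lam_box ext_lam i) (t, w))) z }.

Variables (f : sphere R -> sphere R) (E : affine_extension f).

Definition ext_iter (n : int) : E -> E :=
  match n with
  | Posz m => iter m (@ext_map f E)
  | Negz m => iter m.+1 (@ext_inv f E)
  end.

(* The map [phi] |-> [fhat^n \o phi], defined on S^1-classes of arbitrary maps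
   from the plane to the lamination. Its restriction to hyp3 E is the induced
   action: it preserves hyp3 E because conformal automorphisms of the plane are
   affine. *)
Definition induced_act (n : int) (X : set (C -> E)) : set (C -> E) :=
  [set ext_iter n \o phi | phi in X].

End Extensions.

Arguments induced_act {R f} E n X.

(* Main.v *)
Require Import Defs.
From mathcomp Require Import all_boot all_order all_algebra all_fingroup.
From mathcomp Require Import complex ring lra zify.
From mathcomp Require Import all_classical all_reals all_analysis.

Set Implicit Arguments.
Unset Strict Implicit.
Unset Printing Implicit Defensive.

Import Order.TTheory GRing.Theory Num.Theory.
Import numFieldNormedType.Exports.

Local Open Scope classical_set_scope.
Local Open Scope complex_scope.
Local Open Scope ring_scope.

(** Write [phi] for a chart of a leaf and [pi] for the projection of the
    extension to the sphere, so that [g = pi \o phi] is meromorphic on the whole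
    plane and not constant.

    Iterates of the dynamics.  If the n-th iterate carries a point near [p] to a
    point near [q], with charts [phi'] and [psi'] suitably rotated, then
    [f^n \o g = h] where [g = pi \o phi'] is close to a fixed nonconstant map on
    compact sets and [h = pi \o psi'] oscillates little at a scale independent of [n].
    This is impossible for large [n].  Indeed let [F] be a homogeneous lift of [f]
    to the plane of pairs, [N = d^n], [w] a lift of [g 0] and [v] a lift of [g z].
    The function
<<
      u z = |v /\ w|^N / (|F^n v| |z|^(N-1))
>>
    does not depend on the choice of [v], and is at most [(M |w|)^N / |z|^(N-1)]
    because [|F^n v|] is comparable to [|v|^N] up to [M^N]
    ([iter_lift_map_bounds], where [2 <= d] enters).  On a patch where [h] stays
    away from one of the two poles of the sphere, one coordinate of [F^n v] is
    comparable to its norm, so that [u] is comparable to the modulus of a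
    holomorphic function ([potential_patch]).  As the size of the patches is
    independent of [n], [u] obeys a maximum principle with a constant independent
    of [n] ([barrier_bound]).  On a large square of half-side [r] it yields
    [|v /\ w| <= const^(1/N) M^2 |v| |w| |z|/r], up to inessential exponents: thus
    [g] is nearly constant, a contradiction ([iterates_rigid]).  This replaces
    the Julia set and Montel's theorem by an argument of Liouville type.

    The maximum principle needed is weak, [|m z0| <= 5 sup |m|] over the boundary of
    a square.  It comes from Goursat's bisection, in the form that a
    differentiable divergence-free field cannot point outward along the whole
    boundary of a square ([no_outward_flux], [quasi_maximum]).

    Laminations.  Nearby points of the hyperbolic lamination are close only through
    one box.  That their charts stay close on compact subsets of the plane is shown
    by continuation along segments: leaf curves are determined by their germs
    ([unique_continuation]), and the passage from one box to another is
    continuous in all parameters, up to the finite groups of the boxes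
    ([box_transition]).  Hence evaluating charts is continuous ([value_stable]).

    Vertical flow.  Take disjoint neighbourhoods of [phi u1] and [psi 0] in the
    lamination, where [phi u1 <> psi 0].  If the flow at time [r] takes a point near
    [p] to a point near [q], then [phi'] maps the disc of radius [e^r e] into the
    second one while [phi' u1] lies in the first one; hence [e^r e <= |u1|].
    Exchanging [p] and [q] bounds [r] from below ([flow_time_bounded]). *)

(** * The modulus of a complex number *)

Section Modulus.
Variable R : realType.
Local Notation C := (Cplx R).

(** The norm of the complex field takes its values in the field itself, where the
    order is partial; estimates are made with the real-valued modulus. *)
Definition cmod (z : C) : R := ComplexField.Normc.normc (z : R[i]).

Lemma normC_cmod (z : C) : `|z| = (cmod z)%:C.
Proof. by []. Qed.

Lemma cmod_ge0 z : 0 <= cmod z.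
Proof. by case: z => a b; rewrite /cmod /= sqrtr_ge0. Qed.

Lemma cmodM (z w : C) : cmod (z * w) = cmod z * cmod w.
Proof. exact: ComplexField.Normc.normcM. Qed.

Lemma cmod_eq0 (z : C) : (cmod z == 0) = (z == 0).
Proof. by rewrite -(normr_eq0 z) normC_cmod fmorph_eq0. Qed.

Lemma cmod0 : cmod 0 = 0. Proof. by apply/eqP; rewrite cmod_eq0. Qed.

Lemma cmod1 : cmod 1 = 1. Proof. exact: ComplexField.Normc.normc1. Qed.

Lemma cmod_gt0 (z : C) : (0 < cmod z) = (z != 0).
Proof. by rewrite lt_def cmod_ge0 andbT cmod_eq0. Qed.

Lemma cmodN (z : C) : cmod (- z) = cmod z.
Proof. by apply: complexI; rewrite -!normC_cmod normrN. Qed.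

Lemma cmodBC (z w : C) : cmod (z - w) = cmod (w - z).
Proof. by rewrite -cmodN opprB. Qed.

Lemma cmodV (z : C) : cmod z^-1 = (cmod z)^-1.
Proof. by apply: complexI; rewrite fmorphV -!normC_cmod normfV. Qed.

Lemma cmodX (z : C) n : cmod (z ^+ n) = cmod z ^+ n.
Proof. by apply: complexI; rewrite rmorphXn -!normC_cmod normrX. Qed.

Lemma cmodD (z w : C) : cmod (z + w) <= cmod z + cmod w.
Proof. by rewrite -lecR rmorphD -!normC_cmod; exact: ler_normD. Qed.

Lemma cmodB (z w : C) : cmod (z - w) <= cmod z + cmod w.
Proof. by rewrite (le_trans (cmodD _ _)) // cmodN. Qed.

Lemma cmod_dist (z w : C) : cmod z - cmod w <= cmod (z - w).
Proof. by rewrite lerBlDr -{1}(subrK w z) cmodD. Qed.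

Lemma cmodR (x : R) : cmod x%:C = `|x|.
Proof. by rewrite /cmod /= expr0n addr0 sqrtr_sqr. Qed.

Lemma cmod_nat n : cmod n%:R = n%:R.
Proof. by apply: complexI; rewrite -normC_cmod normr_nat rmorph_nat. Qed.

Lemma cmod2 (z : C) : cmod z ^+ 2 = complex.Re z ^+ 2 + complex.Im z ^+ 2.
Proof.
case: z => a b; by rewrite /cmod /= sqr_sqrtr // addr_ge0 ?sqr_ge0.
Qed.

Lemma Re_le_cmod (z : C) : `|complex.Re z| <= cmod z.
Proof.
rewrite -ler_sqr ?nnegrE ?normr_ge0 ?cmod_ge0 // cmod2 real_normK ?num_real //.
by rewrite lerDl sqr_ge0.
Qed.

Lemma Im_le_cmod (z : C) : `|complex.Im z| <= cmod z.
Proof.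
rewrite -ler_sqr ?nnegrE ?normr_ge0 ?cmod_ge0 // cmod2 real_normK ?num_real //.
by rewrite lerDr sqr_ge0.
Qed.

Lemma cmod_le_ReIm (z : C) : cmod z <= `|complex.Re z| + `|complex.Im z|.
Proof.
rewrite -ler_sqr ?nnegrE ?addr_ge0 ?normr_ge0 ?cmod_ge0 // cmod2.
rewrite sqrrD !real_normK ?num_real // addrAC lerDl.
by rewrite mulrn_wge0 // mulr_ge0.
Qed.

Lemma nearCP (z : C) (P : set C) :
  (\forall u \near z, P u) <->
  exists2 e : R, 0 < e & forall u, cmod (u - z) < e -> P u.
Proof.
split=> [/nbhs_ballP[e /= e0 eP]|[e e0 eP]].
  have re : e = (complex.Re e)%:C by apply/esym/RRe_real/ger0_real/ltW.
  exists (complex.Re e); first by rewrite -ltcR -re.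
  move=> u ue; apply: eP; rewrite /ball /= distrC normC_cmod re.
  by rewrite ltcR.
apply/nbhs_ballP; exists e%:C => /=; first by rewrite ltcR.
by move=> u; rewrite /ball /= distrC normC_cmod ltcR; apply: eP.
Qed.

Lemma near_cmod (z : C) (e : R) : 0 < e -> \forall u \near z, cmod (u - z) < e.
Proof. by move=> e0; apply/nearCP; exists e. Qed.

End Modulus.

Arguments cmod {R} z : simpl never.

(** * Complex differentiability *)

Section Holomorphic.
Variable R : realType.
Local Notation C := (Cplx R).
Implicit Types (e h k : C -> C) (z : C).

Record hol h z : Prop := Hol { hol_derivable : derivable h z 1 }.

Lemma hol_cst (c : C) z : hol (fun=> c) z.
Proof. by constructor; exact: derivable_cst. Qed.

Lemma hol_id z : hol id z.
Proof. by constructor; exact: derivable_id. Qed.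

Lemma holD h k z : hol h z -> hol k z -> hol (fun u => h u + k u) z.
Proof. by move=> [hh] [hk]; constructor; exact: (derivableD hh hk). Qed.

Lemma holB h k z : hol h z -> hol k z -> hol (fun u => h u - k u) z.
Proof. by move=> [hh] [hk]; constructor; exact: (derivableB hh hk). Qed.

Lemma holM h k z : hol h z -> hol k z -> hol (fun u => h u * k u) z.
Proof. by move=> [hh] [hk]; constructor; exact: (derivableM hh hk). Qed.

Lemma holX h n z : hol h z -> hol (fun u => h u ^+ n) z.
Proof.
move=> hh; elim: n => [|n IH]; first exact: hol_cst.
under [X in hol X]eq_fun do rewrite exprS.
exact: holM.
Qed.

Lemma holV h z : h z != 0 -> hol h z -> hol (fun u => (h u)^-1) z.
Proof. by move=> hz [hh]; constructor; exact: (derivableV hz hh). Qed.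

Lemma hol_near h k z : (\forall u \near z, h u = k u) -> hol h z -> hol k z.
Proof. by move=> hk [hh]; constructor; apply: near_eq_derivable hk hh; rewrite oner_eq0. Qed.

Lemma hol_continuous h z : hol h z -> {for z, continuous h}.
Proof. by move=> [/derivable1_diffP/differentiable_continuous]. Qed.

Lemma hol_approx h z : hol h z ->
  exists l : C, forall e : R, 0 < e -> \forall u \near z,
    cmod (h u - h z - l * (u - z)) <= e * cmod (u - z).
Proof.
move=> [dh]; pose D : C := 'D_1 h z; exists D => e e0.
have /cvgr_dist_le/(_ e%:C) : (fun u : C => u^-1 *: (h (u *: (1 : C) + z) - h z)) @ 0^' -->
   'D_1 h z := dh.
rewrite ltcR => /(_ e0).
rewrite near_withinE => /nearCP[r r0 rP]; apply/nearCP; exists r => // u ur.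
have [->|uz] := eqVneq u z; first by rewrite !subrr mulr0 subrr cmod0 mulr0.
have uz0 : u - z != 0 by rewrite subr_eq0.
have := rP (u - z); rewrite subr0 => /(_ ur uz0).
rewrite normC_cmod lecR => H.
have {}H : cmod (D - (u - z)^-1 * (h ((u - z) * 1 + z) - h z)) <= e := H.
rewrite mulr1 subrK in H.
have -> : h u - h z - D * (u - z) = - ((u - z) * (D - (u - z)^-1 * (h u - h z))).
  by rewrite [in RHS]mulrBr mulVKf // opprB [D * _]mulrC.
by rewrite cmodN cmodM mulrC ler_wpM2r // cmod_ge0.
Qed.

Lemma hol_comp m k z : hol k z -> hol m (k z) -> hol (fun u => m (k u)) z.
Proof.
move=> [/derivable1_diffP dk] [/derivable1_diffP dm]; constructor.
by apply/derivable1_diffP; exact: (differentiable_comp dk dm).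
Qed.

(** The difference quotient at [z] is the (N+2)-nd power of the difference quotient
    of [e].  This spares a removable singularity theorem, at the cost of one
    exponent. *)
Lemma hol_divX e z N : hol e z -> e z = 0 ->
  hol (fun u => e u ^+ N.+2 / (u - z) ^+ N.+1) z.
Proof.
move=> [he] ez; constructor; pose D : C := 'D_1 e z.
have he' : (fun u : C => u^-1 *: (e (u *: (1 : C) + z) - e z)) @ 0^' --> D := he.
apply/cvg_ex; exists (D ^+ N.+2).
suff : (fun u : C => (u^-1 *: (e (u *: (1 : C) + z) - e z)) ^+ N.+2) @ 0^' --> D ^+ N.+2.
  apply: cvg_trans; apply: near_eq_cvg; near=> u.
  have u0 : u != 0 by near: u; exact: nbhs_dnbhs_neq.
  rewrite /= -[LHS]/((u^-1 * (e (u * 1 + z) - e z)) ^+ N.+2).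
  rewrite -[RHS]/(u^-1 * (e (u * 1 + z) ^+ N.+2 / (u * 1 + z - z) ^+ N.+1 -
     e z ^+ N.+2 / (z - z) ^+ N.+1)).
  rewrite ez [0 ^+ N.+2]exprS !mul0r !subr0 mulr1 addrK exprMn exprVn.
  rewrite [u ^+ N.+2]exprS invfM -mulrA; congr (_ * _); rewrite mulrC; reflexivity.
have cX : {for D, continuous (fun x : C => x ^+ N.+2)}.
  by apply: hol_continuous; apply: holX; exact: hol_id.
have H := continuous_cvg _ cX he'.
apply: H.
Unshelve. all: by end_near.
Qed.

Lemma hol_sum (I : Type) (s : seq I) (h : I -> C -> C) z :
  (forall i, hol (h i) z) -> hol (fun u => \sum_(i <- s) h i u) z.
Proof.
move=> hh; elim: s => [|i s IH].
  by under [X in hol X]eq_fun do rewrite big_nil; exact: hol_cst.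
under [X in hol X]eq_fun do rewrite big_cons.
exact: (@holD (h i) (fun u => \sum_(j <- s) h j u) z (hh i) IH).
Qed.

End Holomorphic.

(** * Divergence-free fields *)

Section Green.
Variable R : realType.
Implicit Types (P Q : R -> R -> R) (f g : R -> R) (x y s : R).

(** [a] and [- a] are the derivatives of [P] in the first variable and of [Q] in
    the second one.  Only differentiability at the point is required: holomorphic
    functions are not known here to have continuous derivatives. *)
Definition divergence_free P Q x y : Prop := exists a b c : R,
  forall e : R, 0 < e -> exists2 r : R, 0 < r &
    forall x' y', `|x' - x| < r -> `|y' - y| < r ->
      `|P x' y' - P x y - a * (x' - x) - b * (y' - y)| <=
         e * (`|x' - x| + `|y' - y|) /\
      `|Q x' y' - Q x y - c * (x' - x) + a * (y' - y)| <=
         e * (`|x' - x| + `|y' - y|).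

Definition line_int u v f : R :=
  \int[@lebesgue_measure R]_(x in `[u, v]) f x.

Definition cts_on u v f := forall x, u <= x <= v -> {for x, continuous f}.

Lemma cts_on_integrable u v f : cts_on u v f ->
  (@lebesgue_measure R).-integrable `[u, v] (EFin \o f).
Proof.
move=> cf; apply: continuous_compact_integrable; first exact: segment_compact.
apply: continuous_in_subspaceT => x.
by rewrite inE /= in_itv /= => /cf.
Qed.

Lemma line_int_split u w v f : u <= w -> w <= v -> cts_on u v f ->
  line_int u v f = line_int u w f + line_int w v f.
Proof.
move=> uw wv cf; have cf' := cts_on_integrable cf.
have H := @Rintegral_itvB R f (BLeft u) (BRight v) w cf'.
rewrite !bnd_simp in H; have {}H := H uw wv.
apply/eqP; rewrite addrC -subr_eq /line_int H.
apply/eqP/Rintegral_itv_obnd_cbnd.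
apply: integrableS cf' => //; apply: subset_itv; rewrite bnd_simp //.
Qed.

Lemma line_int_leB u v f g k : u <= v -> cts_on u v f -> cts_on u v g ->
  (forall x, u <= x <= v -> f x - g x <= k) ->
  line_int u v f - line_int u v g <= k * (v - u).
Proof.
move=> uv cf cg fg.
have If := cts_on_integrable cf; have Ig := cts_on_integrable cg.
rewrite /line_int -RintegralB //.
have -> : k * (v - u) = \int[@lebesgue_measure R]_(x in `[u, v]) (cst k x).
  rewrite Rintegral_cst //= lebesgue_measure_itv /= lte_fin.
  by have [//|vu] := ltP u v; rewrite (@le_anti _ _ u v) ?uv ?vu // subrr.
apply: le_Rintegral => //.
- by apply: cts_on_integrable => x xuv; apply: continuousB; [exact: cf|exact: cg].
- by apply: cts_on_integrable => x _; exact: cst_continuous.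
Qed.

Lemma near_dist (x e : R) : 0 < e -> \forall t \near x, `|t - x| < e.
Proof.
move=> e0; apply/nbhs_ballP; exists e => //= t.
by rewrite /ball /= distrC.
Qed.

Lemma divergence_free_ctsl P Q x y : divergence_free P Q x y ->
  {for x, continuous (P^~ y)} /\ {for x, continuous (Q^~ y)}.
Proof.
move=> [a [b [c H]]]; have [r r0 Hr] := H 1 ltr01.
have aux (h : R -> R) l : (forall x', `|x' - x| < r ->
    `|h x' - h x - l * (x' - x)| <= `|x' - x|) -> {for x, continuous h}.
  move=> hh; apply/cvgrPdist_lt => e e0; near=> t.
  have tr : `|t - x| < r by near: t; exact: near_dist.
  have te : `|t - x| < e / (`|l| + 1).
    near: t; apply: near_dist; apply: divr_gt0 => //.
  rewrite distrC -(subrK (l * (t - x)) (h t - h x)).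
  apply: le_lt_trans (ler_normD _ _) _.
  apply: le_lt_trans (lerD (hh _ tr) (lexx _)) _.
  rewrite normrM -{1}[`|t - x|]mul1r -mulrDl [1 + _]addrC.
  by rewrite mulrC -ltr_pdivlMr //; exact: ltr_wpDl.
have yr : `|y - y| < r by rewrite subrr normr0.
split; [apply: (aux (P^~ y) a)|apply: (aux (Q^~ y) c)] => x' xr.
  by have [+ _] := Hr x' y xr yr; rewrite subrr normr0 mulr0 subr0 addr0 mul1r.
by have [_] := Hr x' y xr yr; rewrite subrr normr0 mulr0 !addr0 mul1r.
Unshelve. all: end_near.
Qed.

(** Exchanging the axes is a symmetry, so continuity needs a proof in one variable
    only. *)
Lemma divergence_free_swap P Q x y : divergence_free P Q x y ->
  divergence_free (fun y x => Q x y) (fun y x => P x y) y x.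
Proof.
move=> [a [b [c H]]]; exists (- a), c, b => e /H[r r0 Hr].
exists r => // y' x' yr xr; have [H1 H2] := Hr x' y' xr yr.
rewrite [`|y' - y| + _]addrC !mulNr opprK; split.
  by rewrite addrAC.
by rewrite addrAC.
Qed.

Lemma divergence_free_ctsr P Q x y : divergence_free P Q x y ->
  {for y, continuous (P x)} /\ {for y, continuous (Q x)}.
Proof.
by move=> /divergence_free_swap/divergence_free_ctsl[].
Qed.

Definition in_square x0 y0 s x y := (x0 <= x <= x0 + s) && (y0 <= y <= y0 + s).

Definition flux P Q x y s : R :=
  line_int y (y + s) (P (x + s)) - line_int y (y + s) (P x) +
  (line_int x (x + s) (Q^~ (y + s)) - line_int x (x + s) (Q^~ y)).

Section InSquare.
Variables (P Q : R -> R -> R) (X Y S : R).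
Hypothesis PQ : forall x y, in_square X Y S x y -> divergence_free P Q x y.

Definition subsquare x y s :=
  [/\ X <= x, x + s <= X + S, Y <= y & y + s <= Y + S].

Lemma cts_vert x u v : X <= x <= X + S -> Y <= u -> v <= Y + S ->
  cts_on u v (P x).
Proof.
move=> xX uY vY y /andP[uy yv].
have /PQ/divergence_free_ctsr[] // : in_square X Y S x y.
by rewrite /in_square xX (le_trans uY uy) (le_trans yv vY).
Qed.

Lemma cts_horz y u v : Y <= y <= Y + S -> X <= u -> v <= X + S ->
  cts_on u v (Q^~ y).
Proof.
move=> yY uX vX x /andP[ux xv].
have /PQ/divergence_free_ctsl[] // : in_square X Y S x y.
by rewrite /in_square yY (le_trans uX ux) (le_trans xv vX).
Qed.

(** The contributions of the inner edges cancel. *)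
Lemma flux_split x y h : 0 <= h -> subsquare x y (h + h) ->
  flux P Q x y (h + h) = flux P Q x y h + flux P Q (x + h) y h +
    (flux P Q x (y + h) h + flux P Q (x + h) (y + h) h).
Proof.
move=> h0 [Xx xX Yy yY].
have Pint z : X <= z <= X + S -> line_int y (y + (h + h)) (P z) =
    line_int y (y + h) (P z) + line_int (y + h) (y + h + h) (P z).
  move=> zX; rewrite -addrA; apply: line_int_split; rewrite ?lerD2l ?lerDl //.
  exact: cts_vert.
have Qint z : Y <= z <= Y + S -> line_int x (x + (h + h)) (Q^~ z) =
    line_int x (x + h) (Q^~ z) + line_int (x + h) (x + h + h) (Q^~ z).
  move=> zY; rewrite -addrA; apply: line_int_split; rewrite ?lerD2l ?lerDl //.
  exact: cts_horz.
rewrite /flux !Pint ?Qint; try lra.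
rewrite !addrA; ring.
Qed.

Lemma flux_le x y s k l : 0 <= s -> subsquare x y s ->
  (forall y', y <= y' <= y + s -> P (x + s) y' - P x y' <= k) ->
  (forall x', x <= x' <= x + s -> Q x' (y + s) - Q x' y <= l) ->
  flux P Q x y s <= (k + l) * s.
Proof.
move=> s0 [Xx xX Yy yY] Hk Hl; rewrite mulrDl; apply: lerD.
  rewrite (_ : k * s = k * (y + s - y)); last by congr (_ * _); ring.
  by apply: line_int_leB => //; [lra|apply: cts_vert; lra..].
rewrite (_ : l * s = l * (x + s - x)); last by congr (_ * _); ring.
by apply: line_int_leB => //; [lra|apply: cts_horz; lra..].
Qed.

End InSquare.

(** Goursat's bisection: a property that passes from each square to a subsquare of
    half its side holds for arbitrarily small squares around some point. *)
Lemma square_bisection (bad : R -> R -> R -> Prop) X Y S : 0 < S ->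
  (forall x y h, 0 < h -> bad x y (h + h) ->
     exists x' y', [/\ x <= x' <= x + h, y <= y' <= y + h & bad x' y' h]) ->
  bad X Y S ->
  exists x y, forall r, 0 < r -> exists x' y' h,
    [/\ 0 < h < r, x' <= x <= x' + h, y' <= y <= y' + h & bad x' y' h].
Proof.
move=> S0 step badS.
pose h n : R := S * 2^-1 ^+ n.
have h0 n : 0 < h n by rewrite mulr_gt0 // exprn_gt0 // invr_gt0.
have hS n : h n = h n.+1 + h n.+1.
  by rewrite /h exprS; set t := _ ^+ n; field.
have /choice[F HF] : forall np : nat * (R * R), exists p : R * R,
    bad np.2.1 np.2.2 (h np.1) ->
    [/\ np.2.1 <= p.1 <= np.2.1 + h np.1.+1,
        np.2.2 <= p.2 <= np.2.2 + h np.1.+1 & bad p.1 p.2 (h np.1.+1)].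
  case=> n [x y] /=; have [b|nb] := pselect (bad x y (h n)); last by exists (0, 0).
  by rewrite hS in b; have [x' [y' H]] := step _ _ _ (h0 _) b; exists (x', y').
pose s := fix s n : R * R := if n is m.+1 then F (m, s m) else (X, Y).
have sbad n : bad (s n).1 (s n).2 (h n).
  elim: n => [|n IH]; first by rewrite /h expr0 mulr1.
  by have [] := HF (n, s n) IH.
have limit (u : nat -> R) : (forall n, u n <= u n.+1 <= u n + h n.+1) ->
    exists l, forall n, u n <= l <= u n + h n.
  move=> Hu.
  have mono n m : u n <= u (n + m)%N.
    elim: m => [|m IH]; first by rewrite addn0.
    by rewrite addnS (le_trans IH) //; have /andP[] := Hu (n + m)%N.
  have decr n m : u (n + m)%N + h (n + m)%N <= u n + h n.
    elim: m => [|m IH]; first by rewrite addn0.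
    rewrite addnS (le_trans _ IH) //; have /andP[_] := Hu (n + m)%N.
    by rewrite [h (n + m)%N]hS; lra.
  have ub n m : u m <= u n + h n.
    apply: le_trans (decr n m); rewrite addnC.
    by rewrite (le_trans (mono m n)) // lerDl ltW.
  exists (sup (range u)) => n; apply/andP; split.
    apply: ub_le_sup; last by exists n.
    by exists (u 0%N + h 0%N) => _ [m _ <-].
  apply: ge_sup; first by exists (u 0%N), 0%N.
  by move=> _ [m _ <-].
have [x Hx] : exists l, forall n, (s n).1 <= l <= (s n).1 + h n.
  by apply: limit => n; have [] := HF (n, s n) (sbad n).
have [y Hy] : exists l, forall n, (s n).2 <= l <= (s n).2 + h n.
  by apply: limit => n; have [] := HF (n, s n) (sbad n).
exists x, y => r r0.
have [n hn] : exists n, h n < r.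
  have : (fun n => h n) @ \oo --> (0 : R).
    rewrite -(mulr0 S); apply: cvgM; first exact: cvg_cst.
    apply: cvg_expr.
    by rewrite ger0_norm ?invr_ge0 // invf_lt1 // ltr1n.
  move=> /cvgr_lt/(_ r r0)[N _ HN]; exists N; exact: HN (leqnn N).
by exists (s n).1, (s n).2, (h n); rewrite h0.
Qed.

(** Bisection keeps the ratio of flux to area above [kap].  In a small square around
    the limit point, the linear parts of [P] and [Q] contribute opposite fluxes, and
    the error of the approximation is small compared to the area. *)
Lemma no_outward_flux P Q X Y S k : 0 < S -> 0 < k ->
  (forall x y, in_square X Y S x y -> divergence_free P Q x y) ->
  (forall y, Y <= y <= Y + S -> k <= P (X + S) y - P X y) ->
  (forall x, X <= x <= X + S -> k <= Q x (Y + S) - Q x Y) -> False.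
Proof.
move=> S0 k0 PQ HP HQ.
pose kap := (k + k) / S.
have kap0 : 0 < kap by rewrite divr_gt0 // addr_gt0.
pose bad x y h := subsquare X Y S x y h /\ kap * h ^+ 2 <= flux P Q x y h.
have badS : bad X Y S.
  split; first by split.
  have -> : kap * S ^+ 2 = (k + k) * S by rewrite /kap; field; rewrite gt_eqF.
  rewrite mulrDl; apply: lerD.
    rewrite -lerN2 opprB -mulNr (_ : - k * S = - k * (Y + S - Y)); last first.
      by congr (_ * _); ring.
    apply: line_int_leB; try lra; try by apply: (cts_vert PQ); lra.
    by move=> y /HP; lra.
  rewrite -lerN2 opprB -mulNr (_ : - k * S = - k * (X + S - X)); last first.
    by congr (_ * _); ring.
  apply: line_int_leB; try lra; try by apply: (cts_horz PQ); lra.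
  by move=> x /HQ; lra.
have [|x [y Hxy]] := @square_bisection bad X Y S S0 _ badS.
  move=> x y h hh0 [sub fl].
  have [Xx xX Yy yY] := sub.
  have S1 : subsquare X Y S x y h by split; lra.
  have S2 : subsquare X Y S (x + h) y h by split; lra.
  have S3 : subsquare X Y S x (y + h) h by split; lra.
  have S4 : subsquare X Y S (x + h) (y + h) h by split; lra.
  rewrite (flux_split PQ) // in fl; last exact: ltW.
  have E : kap * (h + h) ^+ 2 = kap * h ^+ 2 + kap * h ^+ 2 +
     (kap * h ^+ 2 + kap * h ^+ 2) by ring.
  rewrite E in fl.
  have [b1|b1] := leP (kap * h ^+ 2) (flux P Q x y h).
    by exists x, y; split; [lra|lra|split].
  have [b2|b2] := leP (kap * h ^+ 2) (flux P Q (x + h) y h).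
    by exists (x + h), y; split; [lra|lra|split].
  have [b3|b3] := leP (kap * h ^+ 2) (flux P Q x (y + h) h).
    by exists x, (y + h); split; [lra|lra|split].
  exists (x + h), (y + h); split; [lra|lra|split => //]; lra.
have xyS : in_square X Y S x y.
  have [x' [y' [h [/andP[hh0 _] /andP[x1 x2] /andP[y1 y2] [[? ? ? ?] _]]]]] := Hxy 1 ltr01.
  by apply/andP; split; lra.
have [a [b [c H]]] := PQ _ _ xyS.
have [r r0 Hr] := H (kap / 16) (divr_gt0 kap0 (ltr0n _ 16)).
have [x' [y' [h [/andP[hh0 hr] /andP[x1 x2] /andP[y1 y2] [sub fl]]]]] := Hxy r r0.
have near0 u : x' <= u <= x' + h -> `|u - x| <= h.
  by move=> /andP[? ?]; rewrite ler_norml; lra.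
have near1 u : y' <= u <= y' + h -> `|u - y| <= h.
  by move=> /andP[? ?]; rewrite ler_norml; lra.
have err u v : x' <= u <= x' + h -> y' <= v <= y' + h ->
  `|P u v - P x y - a * (u - x) - b * (v - y)| <= kap / 16 * (h + h) /\
  `|Q u v - Q x y - c * (u - x) + a * (v - y)| <= kap / 16 * (h + h).
  move=> /near0 un /near1 vn.
  have [H1 H2] := Hr u v (le_lt_trans un hr) (le_lt_trans vn hr).
  have le2 : kap / 16 * (`|u - x| + `|v - y|) <= kap / 16 * (h + h).
    by apply: ler_wpM2l; [lra|exact: lerD].
  by split; [apply: le_trans H1 le2|apply: le_trans H2 le2].
have : flux P Q x' y' h <= ((a * h + kap / 4 * h) + (- a * h + kap / 4 * h)) * h.
  apply: (flux_le PQ) => //; first exact: ltW.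
    have xl : x' <= x' <= x' + h by lra.
    have xr : x' <= x' + h <= x' + h by lra.
    move=> v vy; have [+ _] := err _ v xl vy; have [+ _] := err _ v xr vy.
    rewrite !ler_norml; lra.
  have yl : y' <= y' <= y' + h by lra.
  have yr : y' <= y' + h <= y' + h by lra.
  move=> u ux; have [_] := err u _ ux yr; have [_] := err u _ ux yl.
  rewrite !ler_norml; lra.
apply/negP; rewrite -ltNge; apply: lt_le_trans fl.
have -> : (a * h + kap / 4 * h + (- a * h + kap / 4 * h)) * h = kap / 2 * h ^+ 2.
  by field.
by rewrite ltr_pM2r ?exprn_gt0 //; lra.
Qed.

End Green.

(** * A weak maximum principle *)

Section QuasiMaximum.
Variable R : realType.
Local Notation C := (Cplx R).
Implicit Types (m : C -> C) (z : C).

Definition csquare z0 (d : R) (z : C) : bool :=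
  (`|complex.Re (z - z0)| <= d) && (`|complex.Im (z - z0)| <= d).

(** A Cauchy-Riemann equation; the flux of this field is the imaginary part of the
    contour integral of [W]. *)
Lemma hol_divergence_free (W : C -> C) (x y : R) : hol W (x +i* y) ->
  divergence_free (fun x y => complex.Re (W (x +i* y)))
                  (fun x y => - complex.Im (W (x +i* y))) x y.
Proof.
move=> /hol_approx[[a b] H]; exists a, (- b), (- b) => e e0.
have /nearCP[r r0 Hr] := H e e0.
exists (r / 2); first by rewrite divr_gt0.
move=> x' y' xr yr.
have dz : (x' +i* y' : C) - (x +i* y) = (x' - x) +i* (y' - y) by [].
have le1 : cmod ((x' +i* y' : C) - (x +i* y)) <= `|x' - x| + `|y' - y|.
  by rewrite dz; exact: cmod_le_ReIm.
have lr : cmod ((x' +i* y' : C) - (x +i* y)) < r.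
  by apply: le_lt_trans le1 _; lra.
have {}Hr := Hr _ lr.
have Hle := le_trans Hr (ler_wpM2l (ltW e0) le1).
move: (le_trans (Re_le_cmod _) Hle) (le_trans (Im_le_cmod _) Hle).
rewrite dz; case: (W (x' +i* y')) => u' v'; case: (W (x +i* y)) => u v /= H1 H2.
split.
  apply: le_trans H1; rewrite le_eqVlt; apply/orP; left; apply/eqP; congr `|_|.
  ring.
apply: le_trans H2; rewrite -normrN le_eqVlt; apply/orP; left; apply/eqP; congr `|_|.
ring.
Qed.

Lemma Re_inv_ge (d t : R) : 0 < d -> `|t| <= d -> 1 / (2 * d) <= d / (d ^+ 2 + t ^+ 2).
Proof.
move=> d0 td.
have t2 : t ^+ 2 <= d ^+ 2 by rewrite -[t ^+ 2]real_normK ?num_real // ler_sqr ?nnegrE // ltW.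
have dd : 0 < d ^+ 2 by rewrite exprn_gt0.
have tt : 0 <= t ^+ 2 by rewrite sqr_ge0.
rewrite ler_pdivrMr ?mulr_gt0 // mulrAC ler_pdivlMr; last by lra.
by nra.
Qed.

(** Suppose [5 * L < |m z0|] and put [n = m / m z0].  Then
    [W = (n - 1)^2 / (z - z0)] is holomorphic, and equals
    [1 / (z - z0) + (n^2 - 2 n) / (z - z0)].  On the boundary [|n| < 1/5], so the
    first term dominates, and the field of [W] points outward along each side. The
    constant 5 does no harm: the barrier below absorbs any constant. *)
Lemma quasi_maximum m z0 (d L : R) : 0 < d -> 0 <= L ->
  (forall z, csquare z0 d z -> hol m z) ->
  (forall z, csquare z0 d z -> d <= cmod (z - z0) -> cmod (m z) <= L) ->
  cmod (m z0) <= 5 * L.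
Proof.
move=> d0 L0 hm mL; rewrite leNgt; apply/negP => LA.
set A := m z0 in LA.
have A0 : A != 0 by rewrite -cmod_gt0; lra.
pose n z := m z / A; pose l := L / cmod A.
have cA : 0 < cmod A by rewrite cmod_gt0.
have l0 : 0 <= l by rewrite divr_ge0 // ltW.
have l5 : l < 1 / 5 by rewrite /l ltr_pdivrMr //; lra.
have hn z : csquare z0 d z -> hol n z.
  by move=> /hm hmz; apply: (@holM _ m (fun=> A^-1)); [exact: hmz|exact: hol_cst].
have nl z : csquare z0 d z -> d <= cmod (z - z0) -> cmod (n z) <= l.
  move=> s1 s2; rewrite /n cmodM cmodV /l ler_wpM2r ?invr_ge0 ?cmod_ge0 //.
  exact: mL.
have n0 : n z0 = 1 by rewrite /n divff.
pose W z := (n z - 1) ^+ 2 / (z - z0) ^+ 1.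
have hW z : csquare z0 d z -> hol W z.
  move=> sz; have hn1 : hol (fun u => n u - 1) z by apply: holB; [exact: hn|exact: hol_cst].
  have [->|zz0] := eqVneq z z0.
    apply: hol_divX; last by rewrite n0 subrr.
    apply: holB; last exact: hol_cst.
    by apply: hn; rewrite /csquare subrr /= normr0 ltW.
  apply: holM; first exact: holX.
  apply: holV; first by rewrite expr1 subr_eq0.
  by apply: holX; apply: holB; [exact: hol_id|exact: hol_cst].
have Wbd z : csquare z0 d z -> d <= cmod (z - z0) ->
    cmod (W z - (z - z0)^-1) <= (11 / 25) / d.
  move=> s1 s2.
  have -> : W z - (z - z0)^-1 = (n z ^+ 2 - 2 * n z) / (z - z0).
    by rewrite /W expr1 -{2}[(z - z0)^-1]mul1r -mulrBl; congr (_ / _); ring.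
  rewrite cmodM cmodV; have := nl z s1 s2; move: (n z) => w wl.
  apply: ler_pM; rewrite ?invr_ge0 ?cmod_ge0 //.
    apply: le_trans (cmodB _ _) _; rewrite cmodX cmodM cmod_nat.
    have := cmod_ge0 w; nra.
  by rewrite lef_pV2 ?posrE // (lt_le_trans d0).
pose k := 3 / 50 / d.
have k0 : 0 < k by rewrite /k !divr_gt0.
have kE : 1 / (2 * d) - (11 / 25) / d = k by rewrite /k; field; rewrite gt_eqF.
(* [nu] is the outward unit normal of a side, [t] the position on that side *)
have side (nu : C) (t : R) z : cmod nu = 1 -> `|t| <= d ->
    z - z0 = nu * (d +i* t) -> csquare z0 d z -> k <= complex.Re (nu * W z).
  move=> nu1 td zE zin.
  have nu0 : nu != 0 by rewrite -cmod_gt0 nu1.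
  have zd : d <= cmod (z - z0).
    rewrite zE cmodM nu1 mul1r (le_trans _ (Re_le_cmod _)) //=.
    by rewrite ler_norm.
  have H : `|complex.Re (nu * (W z - (z - z0)^-1))| <= 11 / 25 / d.
    by rewrite (le_trans (Re_le_cmod _)) // cmodM nu1 mul1r; exact: Wbd.
  have -> : nu * W z = nu * (W z - (z - z0)^-1) + (d +i* t)^-1.
    by rewrite mulrBr zE invfM mulVKf // subrK.
  have -> : (d +i* t)^-1 =
    (d / (d ^+ 2 + t ^+ 2)) +i* (- (t / (d ^+ 2 + t ^+ 2))) :> C by [].
  have := Re_inv_ge d0 td; rewrite -kE.
  move: H; rewrite ler_norml raddfD /=; lra.
case: z0 @A LA A0 @n @l cA l0 l5 hn nl n0 @W hW side Wbd hm mL => X0 Y0.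
move=> A LA A0 n l cA l0 l5 hn nl n0 W hW side Wbd _ _.
have sq x y : X0 - d <= x <= X0 + d -> Y0 - d <= y <= Y0 + d ->
   csquare (X0 +i* Y0) d (x +i* y).
  by move=> xx yy; rewrite /csquare /= !ler_norml; apply/andP; split; lra.
have dE (u v x : R) : u = x + v -> u - x = v by move=> ->; ring.
have Dd : X0 - d + 2 * d = X0 + d by ring.
have Ee : Y0 - d + 2 * d = Y0 + d by ring.
apply: (@no_outward_flux R (fun x y => complex.Re (W (x +i* y)))
         (fun x y => - complex.Im (W (x +i* y))) (X0 - d) (Y0 - d) (2 * d) k).
- by rewrite mulr_gt0.
- by [].
- move=> x y; rewrite /in_square Dd Ee => /andP[xx yy].
  by apply: hol_divergence_free; apply: hW; exact: sq.
- rewrite Dd Ee => y yy.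
  have yd : `|y - Y0| <= d by rewrite ler_norml; lra.
  have yd' : `|Y0 - y| <= d by rewrite distrC.
  have Hr := side (1 +i* 0) (y - Y0) ((X0 + d) +i* y) (cmod1 R) yd.
  have Hl := side ((-1) +i* 0) (Y0 - y) ((X0 - d) +i* y) _ yd'.
  have {}Hr : k <= complex.Re ((1 +i* 0 : C) * W ((X0 + d) +i* y)).
    apply: Hr; last by apply: sq; lra.
    by apply/eqP; rewrite eq_complex /=; apply/andP; split; apply/eqP; ring.
  have {}Hl : k <= complex.Re (((-1) +i* 0 : C) * W ((X0 - d) +i* y)).
    apply: Hl; [|
      by apply/eqP; rewrite eq_complex /=; apply/andP; split; apply/eqP; ring|
      by apply: sq; lra].
    by rewrite /cmod /= sqrrN expr1n expr0n addr0 sqrtr1.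
  move: Hr Hl; case: (W _) => ? ?; case: (W _) => ? ? /=; lra.
rewrite Dd Ee => x xx.
have xd : `|x - X0| <= d by rewrite ler_norml; lra.
have xd' : `|X0 - x| <= d by rewrite distrC.
have Ht := side (0 +i* 1) (X0 - x) (x +i* (Y0 + d)) _ xd'.
have Hb := side (0 +i* (-1)) (x - X0) (x +i* (Y0 - d)) _ xd.
have {}Ht : k <= complex.Re ((0 +i* 1 : C) * W (x +i* (Y0 + d))).
  apply: Ht; [|
    by apply/eqP; rewrite eq_complex /=; apply/andP; split; apply/eqP; ring|
    by apply: sq; lra].
  by rewrite /cmod /= expr1n expr0n add0r sqrtr1.
have {}Hb : k <= complex.Re ((0 +i* (-1) : C) * W (x +i* (Y0 - d))).
  apply: Hb; [|
    by apply/eqP; rewrite eq_complex /=; apply/andP; split; apply/eqP; ring|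
    by apply: sq; lra].
  by rewrite /cmod /= sqrrN expr1n expr0n add0r sqrtr1.
move: Ht Hb; case: (W _) => ? ?; case: (W _) => ? ? /=; lra.
Qed.
End QuasiMaximum.

(** * Functions locally comparable to moduli of holomorphic functions *)

Section Barrier.
Variable R : realType.
Local Notation C := (Cplx R).

Lemma csquareD (z0 z : C) (r d : R) : csquare 0 (r - d) z0 -> csquare z0 d z ->
  csquare 0 r z.
Proof.
rewrite /csquare !subr0 !raddfB /= !ler_norml; lra.
Qed.

Lemma csquare_cmod (z : C) (r : R) : csquare 0 r z -> cmod z ^+ 2 <= 2 * r ^+ 2.
Proof.
rewrite /csquare subr0 cmod2 => /andP[H1 H2].
have r0 : 0 <= r by apply: le_trans H1.
have sq (a : R) : `|a| <= r -> a ^+ 2 <= r ^+ 2.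
  by move=> ar; rewrite -[a ^+ 2]real_normK ?num_real // ler_sqr ?nnegrE.
by have := sq _ H1; have := sq _ H2; lra.
Qed.

(** At [z = w] both sides are the square of [1 + |w|^2]; elsewhere the left one falls
    short of the product by [|z - w|^2].  This makes the powers of [1 + |z|^2] a
    barrier: they exceed the moduli of suitable polynomials by a definite factor at
    a definite distance from [w]. *)
Lemma chordal_identity (z w : C) :
  cmod (1 + conjc (w : R[i]) * z) ^+ 2 =
  (1 + cmod w ^+ 2) * (1 + cmod z ^+ 2) - cmod (z - w) ^+ 2.
Proof.
rewrite !cmod2; case: z => a b; case: w => c d /=; ring.
Qed.

(** Let [b z = 1 + |z|^2] and let [S] be the supremum of [u^2 b^K] over the square.
    At [z0] in the inner square, the weak maximum principle for
    [m z (1 + conj z0 z)^K] and the chordal identity give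
    [u^2 b^K <= 225 th^K S] with [th < 1].  For [K] large, depending on [r] and [d]
    only, this is at most [S / 2], so the supremum is controlled by the values
    close to the boundary. *)
Lemma barrier_bound (r d : R) : 0 < d -> exists2 B : R, 0 < B &
  forall (u : C -> R) (Y M : R), 0 <= Y ->
    (forall z, 0 <= u z) ->
    (forall z, csquare 0 r z -> u z <= M) ->
    (forall z, csquare 0 r z -> ~~ csquare 0 (r - d) z -> u z <= Y) ->
    (forall z0, csquare 0 (r - d) z0 -> exists m : C -> C,
       forall z, csquare z0 d z ->
         hol m z /\ u z <= cmod (m z) <= 3 * u z) ->
    forall z, csquare 0 r z -> u z <= Y * B.
Proof.
move=> d0.
pose b := 1 + 2 * r ^+ 2.
have b1 : 1 <= b by rewrite lerDl mulr_ge0 // sqr_ge0.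
have b0 : 0 < b by apply: lt_le_trans b1.
have bb0 : 0 < b ^+ 2 by rewrite exprn_gt0.
(* the maximum with 0 only ensures that powers of [th] are nonnegative *)
pose th := Num.max 0 (1 - d ^+ 2 / b ^+ 2).
have th0 : 0 <= th by rewrite le_max lexx.
have th1 : th < 1.
  by rewrite gt_max ltr01 /= ltrBlDr ltrDl divr_gt0 // exprn_gt0.
have [K HK] : exists K, 225 * th ^+ K <= 1 / 2.
  have : (fun n => th ^+ n) @ \oo --> (0 : R).
    by apply: cvg_expr; rewrite ger0_norm.
  move=> /cvgr_lt/(_ (1 / 450)) []; first by rewrite divr_gt0.
  by move=> N _ /(_ N (leqnn N)) /= H; exists N; lra.
exists (b ^+ K); first by rewrite exprn_gt0.
move=> u Y M Y0 u0 uM uY um z1 z1r.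
pose bz (z : C) := 1 + cmod z ^+ 2.
have bz1 z : 1 <= bz z by rewrite lerDl sqr_ge0.
have bz0 z : 0 < bz z by apply: lt_le_trans (bz1 z).
have bzb z : csquare 0 r z -> bz z <= b by move=> /csquare_cmod; rewrite /bz /b; lra.
pose T z := u z ^+ 2 * bz z ^+ K.
pose D := [set T z | z in [set z | csquare 0 r z]].
have Tub : has_ubound D.
  exists (M ^+ 2 * b ^+ K) => _ [z zr <-].
  have M0 : 0 <= M by apply: le_trans (u0 z) (uM _ zr).
  apply: ler_pM; rewrite ?sqr_ge0 ?exprn_ge0 // ?(ltW (bz0 _)) //.
    by rewrite ler_sqr ?nnegrE // uM.
  by rewrite lerXn2r ?nnegrE ?bzb // ltW.
have DS z : csquare 0 r z -> T z <= sup D by move=> zr; apply: ub_le_sup => //; exists z.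
set S := sup D in DS.
have S0 : 0 <= S.
  by apply: le_trans (DS _ z1r); rewrite mulr_ge0 ?sqr_ge0 // exprn_ge0 // ltW.
have Tin z0 : csquare 0 (r - d) z0 -> T z0 <= S / 2.
  move=> z0r; have [m Hm] := um z0 z0r.
  have z0d : csquare z0 d z0 by rewrite /csquare subrr /= normr0 ltW.
  pose e z : C := (1 + conjc (z0 : R[i]) * z) ^+ K.
  have he z : hol e z.
    apply: holX; apply: (@holD _ (fun=> 1) (fun z => conjc (z0 : R[i]) * z)).
      exact: hol_cst.
    apply: (@holM _ (fun=> conjc (z0 : R[i])) id); [exact: hol_cst|exact: hol_id].
  have ez0 : cmod (e z0) = bz z0 ^+ K.
    rewrite /e cmodX; congr (_ ^+ _).
    apply/eqP; rewrite -(@eqrXn2 _ 2) ?cmod_ge0 ?(ltW (bz0 _)) //.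
    by rewrite chordal_identity subrr cmod0 expr0n subr0 -expr2.
  have eb z : csquare z0 d z -> d <= cmod (z - z0) ->
      cmod (e z) ^+ 2 <= (bz z0 * bz z * th) ^+ K.
    move=> zd dz; rewrite /e cmodX exprAC.
    rewrite lerXn2r ?nnegrE ?sqr_ge0 ?mulr_ge0 ?(ltW (bz0 _)) //.
    rewrite chordal_identity -/(bz z0) -/(bz z).
    set p := bz z0 * bz z.
    have pb : p <= b ^+ 2.
      have zr := csquareD z0r zd.
      have z0r' := csquareD z0r z0d.
      by rewrite expr2 ler_pM ?bzb // ltW.
    have p0 : 0 < p by rewrite mulr_gt0.
    apply: le_trans (_ : p * (1 - d ^+ 2 / b ^+ 2) <= _); last first.
      by rewrite ler_pM2l // le_max lexx orbT.
    rewrite mulrBr mulr1 lerD2l lerN2.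
    apply: le_trans (_ : d ^+ 2 <= _); last first.
      by rewrite ler_sqr ?nnegrE // ?cmod_ge0 // ltW.
    by rewrite mulrCA ler_piMr ?sqr_ge0 // ler_pdivrMr // mul1r.
  pose L2 := 9 * (S * bz z0 ^+ K * th ^+ K).
  have L20 : 0 <= L2.
    by rewrite !mulr_ge0 // exprn_ge0 // ltW.
  have Hq : cmod (m z0 * e z0) <= 5 * Num.sqrt L2.
    apply: (@quasi_maximum _ (fun z => m z * e z) z0 d) => //.
    - by move=> z /Hm[hmz _]; apply: (@holM _ m e z); [exact: hmz|exact: he].
    move=> z zd dz; have [_ /andP[_ mz]] := Hm z zd.
    rewrite -ler_sqr ?nnegrE ?cmod_ge0 ?sqrtr_ge0 // sqr_sqrtr // cmodM exprMn.
    have := eb z zd dz; rewrite !exprMn => ez.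
    have m9 : cmod (m z) ^+ 2 <= 9 * u z ^+ 2.
      rewrite (_ : 9 * u z ^+ 2 = (3 * u z) ^+ 2); last by ring.
      by rewrite ler_sqr ?nnegrE ?cmod_ge0 ?mulr_ge0.
    apply: le_trans (ler_pM _ _ m9 ez) _; rewrite ?sqr_ge0 //.
    have -> : 9 * u z ^+ 2 * (bz z0 ^+ K * bz z ^+ K * th ^+ K) =
      9 * (T z * bz z0 ^+ K * th ^+ K) by rewrite /T; ring.
    rewrite /L2 ler_pM2l // ler_wpM2r ?exprn_ge0 // ler_wpM2r ?exprn_ge0 ?(ltW (bz0 _)) //.
    exact: DS (csquareD z0r zd).
  have [_ /andP[um0 _]] := Hm z0 z0d.
  have bK : 0 < bz z0 ^+ K by rewrite exprn_gt0.
  have : (u z0 * bz z0 ^+ K) ^+ 2 <= 25 * L2.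
    rewrite -[X in _ <= 25 * X]sqr_sqrtr // (_ : 25 = 5 ^+ 2); last by ring.
    rewrite -exprMn ler_sqr ?nnegrE ?mulr_ge0 ?sqrtr_ge0 ?(ltW bK) //.
    by apply: le_trans Hq; rewrite cmodM ez0 ler_pM2r.
  have -> : (u z0 * bz z0 ^+ K) ^+ 2 = T z0 * bz z0 ^+ K by rewrite /T; ring.
  have -> : 25 * L2 = (225 * th ^+ K * S) * bz z0 ^+ K by rewrite /L2; ring.
  rewrite ler_pM2r // => /le_trans; apply.
  by rewrite mulrC ler_wpM2l // -div1r.
have Tout z : csquare 0 r z -> ~~ csquare 0 (r - d) z -> T z <= Y ^+ 2 * b ^+ K.
  move=> zr zn; apply: ler_pM; rewrite ?sqr_ge0 ?exprn_ge0 // ?(ltW (bz0 _)) //.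
    by rewrite ler_sqr ?nnegrE // uY.
  by rewrite lerXn2r ?nnegrE ?bzb // ltW.
have SY : S <= Y ^+ 2 * b ^+ K.
  rewrite leNgt; apply/negP => YS.
  have YB0 : 0 <= Y ^+ 2 * b ^+ K by rewrite mulr_ge0 ?sqr_ge0 // exprn_ge0 // ltW.
  have : S <= Num.max (S / 2) (Y ^+ 2 * b ^+ K).
    apply: ge_sup; first by exists (T z1), z1.
    move=> _ [z zr <-]; rewrite le_max.
    by have [/Tin -> //|/Tout -> //] := boolP (csquare 0 (r - d) z); rewrite orbT.
  by rewrite le_max => /orP[]; lra.
have bK1 : 1 <= b ^+ K by rewrite exprn_ege1.
rewrite -ler_sqr ?nnegrE ?mulr_ge0 ?(le_trans ler01 bK1) //.
apply: le_trans (_ : T z1 <= _).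
  by rewrite ler_peMr ?sqr_ge0 // exprn_ege1.
apply: le_trans (DS _ z1r) _; apply: le_trans SY _.
rewrite exprMn ler_wpM2l ?sqr_ge0 // expr2 ler_peMl //.
exact: le_trans ler01 bK1.
Qed.

End Barrier.

(** * Homogeneous coordinates on the sphere *)

Section HomogeneousLift.
Variable R : realType.
Local Notation C := (Cplx R).
Implicit Types (p q : {poly C}) (v w : C * C).

Definition homog (D : nat) p v : C :=
  \sum_(i < D.+1) p`_i * v.1 ^+ i * v.2 ^+ (D - i).

Definition sphere_of v : sphere R := if v.2 == 0 then None else Some (v.1 / v.2).

Definition vscale (c : C) v : C * C := (c * v.1, c * v.2).

Definition vnorm v : R := cmod v.1 + cmod v.2.

(** Up to a bounded factor, the chordal distance of two points is
    [|wedge v w| / (|v| |w|)] for any lifts [v] and [w]. *)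
Definition wedge v w : C := v.1 * w.2 - v.2 * w.1.

Lemma homog_fin D p (a b : C) : (size p <= D.+1)%N -> b != 0 ->
  homog D p (a, b) = b ^+ D * p.[a / b].
Proof.
move=> sp b0; rewrite (horner_coef_wide _ sp) mulr_sumr.
apply: eq_bigr => i _ /=; have iD : (i <= D)%N by rewrite -ltnS.
have -> : b ^+ D = b ^+ (D - i) * b ^+ i by rewrite -exprD subnK.
by rewrite expr_div_n; field; rewrite expf_neq0.
Qed.

Lemma homog_inf D p (a : C) : homog D p (a, 0) = p`_D * a ^+ D.
Proof.
rewrite /homog big_ord_recr /= subnn expr0 mulr1 big1 ?add0r // => i _.
by rewrite expr0n subn_eq0 leqNgt ltn_ord /= mulr0.
Qed.

Lemma homogZ D p c v : homog D p (vscale c v) = c ^+ D * homog D p v.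
Proof.
rewrite /homog mulr_sumr; apply: eq_bigr => i _ /=.
have iD : (i <= D)%N by rewrite -ltnS.
have -> : c ^+ D = c ^+ (D - i) * c ^+ i by rewrite -exprD subnK.
by rewrite !exprMn; ring.
Qed.

Lemma vnorm_ge0 v : 0 <= vnorm v.
Proof. by rewrite addr_ge0 ?cmod_ge0. Qed.

Lemma vnorm_gt0 v : (0 < vnorm v) = (v != (0, 0)).
Proof.
case: v => a b; rewrite lt_def vnorm_ge0 andbT /vnorm /=.
by rewrite paddr_eq0 ?cmod_ge0 // !cmod_eq0.
Qed.

Lemma vnormZ c v : vnorm (vscale c v) = cmod c * vnorm v.
Proof. by rewrite /vnorm /= !cmodM mulrDr. Qed.

Lemma wedgexx (v : C * C) : wedge v v = 0.
Proof. by rewrite /wedge [v.2 * _]mulrC subrr. Qed.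

Lemma wedge_sym (v w : C * C) : cmod (wedge v w) = cmod (wedge w v).
Proof. by rewrite /wedge cmodBC; congr cmod; ring. Qed.

Lemma wedgeZ c v w : wedge (vscale c v) w = c * wedge v w.
Proof. by rewrite /wedge /= mulrBr !mulrA. Qed.

Lemma wedge_le v w : cmod (wedge v w) <= vnorm v * vnorm w.
Proof.
apply: le_trans (cmodB _ _) _; rewrite !cmodM /vnorm.
have := cmod_ge0 v.1; have := cmod_ge0 v.2.
have := cmod_ge0 w.1; have := cmod_ge0 w.2; nra.
Qed.

Lemma sphere_of_inj v w : v != (0, 0) -> w != (0, 0) -> sphere_of v = sphere_of w ->
  exists2 c, c != 0 & v = vscale c w.
Proof.
case: v w => [a b] [a' b']; rewrite /sphere_of /vscale /= !xpair_eqE.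
have [->|b0] := eqVneq b 0; have [->|b0'] := eqVneq b' 0 => //=.
  rewrite !andbT => a0 a0' _; exists (a / a'); first by rewrite mulf_neq0 ?invr_eq0.
  by rewrite divfK // mulr0.
move=> _ _ [E]; exists (b / b'); first by rewrite mulf_neq0 ?invr_eq0.
rewrite divfK //; congr (_, _).
by rewrite mulrAC -mulrA -E mulrC divfK.
Qed.

Definition std_lift (x : sphere R) : C * C := if x is Some z then (z, 1) else (1, 0).

Lemma std_lift_neq0 x : std_lift x != (0, 0).
Proof. by case: x => [z|]; rewrite /std_lift /= xpair_eqE oner_eq0 ?andbF. Qed.

Lemma sphere_of_std_lift x : sphere_of (std_lift x) = x.
Proof. by case: x => [z|]; rewrite /sphere_of /= ?oner_eq0 ?divr1 ?eqxx. Qed.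

Lemma poly_bounded p : exists2 K : R, 0 < K &
  forall x, cmod x <= 1 -> cmod p.[x] <= K.
Proof.
elim/poly_ind: p => [|p c [K K0 HK]].
  by exists 1 => // x _; rewrite horner0 cmod0.
exists (K + cmod c + 1).
  by rewrite ltr_pwDr // addr_ge0 ?cmod_ge0 // ltW.
move=> x x1; rewrite hornerMXaddC; apply: le_trans (cmodD _ _) _.
rewrite cmodM; have := HK x x1; have := cmod_ge0 p.[x]; have := cmod_ge0 x; nra.
Qed.

(** By Bezout's identity [u p + v q = 1]. *)
Lemma coprimep_lower_bound p q : coprimep p q -> exists2 c : R, 0 < c &
  forall x, cmod x <= 1 -> c <= cmod p.[x] + cmod q.[x].
Proof.
move=> /Bezout_eq1_coprimepP[[u v] /= E].
have [K K0 HK] := poly_bounded u; have [L L0 HL] := poly_bounded v.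
have KL : 0 < K + L by rewrite addr_gt0.
exists (K + L)^-1; first by rewrite invr_gt0.
move=> x x1; rewrite -div1r ler_pdivrMr //.
have := congr1 (fun r => cmod r.[x]) E; rewrite hornerD !hornerM hornerC cmod1 => E1.
rewrite -[X in X <= _]E1; apply: le_trans (cmodD _ _) _; rewrite !cmodM.
have := HK x x1; have := HL x x1.
have := cmod_ge0 p.[x]; have := cmod_ge0 q.[x].
have := cmod_ge0 u.[x]; have := cmod_ge0 v.[x]; nra.
Qed.

(** The dehomogenization of [homog D p] in the chart at infinity. *)
Definition poly_rev (D : nat) p : {poly C} := \poly_(i < D.+1) p`_(D - i).

Lemma poly_revE D p x : (poly_rev D p).[x] = homog D p (1, x).
Proof.
rewrite horner_poly /homog (reindex_inj rev_ord_inj) /=.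
apply: eq_bigr => i _; have iD : (i <= D)%N by rewrite -ltnS.
by rewrite expr1n mulr1 subSS subKn.
Qed.

End HomogeneousLift.

(** * Homogeneous lifts of rational maps *)

Section RationalLift.
Variable R : realType.
Local Notation C := (Cplx R).
Variables (p q : {poly C}) (d : nat).
Hypotheses (pq : coprimep p q) (pqd : maxn (size p) (size q) = d.+1).
Hypothesis (d2 : (2 <= d)%N).

Definition lift_map (v : C * C) : C * C := (homog d p v, homog d q v).

Let sp : (size p <= d.+1)%N. Proof. by rewrite -pqd leq_maxl. Qed.
Let sq : (size q <= d.+1)%N. Proof. by rewrite -pqd leq_maxr. Qed.

Let lead_neq0 : (p`_d != 0) || (q`_d != 0).
Proof.
have [s|s] := leqP (size p) (size q).
  move: pqd; rewrite (maxn_idPr s) => E.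
  by rewrite -[q`_d]/(q`_(d.+1.-1)) -E -lead_coefE lead_coef_eq0 -size_poly_gt0 E orbT.
move: pqd; rewrite (maxn_idPl (ltnW s)) => E.
by rewrite -[p`_d]/(p`_(d.+1.-1)) -E -lead_coefE lead_coef_eq0 -size_poly_gt0 E.
Qed.

Lemma lift_map_neq0 v : v != (0, 0) -> lift_map v != (0, 0).
Proof.
case: v => a b; rewrite /lift_map !xpair_eqE.
have [->|b0] := eqVneq b 0.
  rewrite andbT !homog_inf => a0; rewrite !mulf_eq0 !expf_eq0 (negPf a0) !andbF !orbF.
  by rewrite negb_and.
move=> _; rewrite !homog_fin // !mulf_eq0 !expf_eq0 (negPf b0) !andbF /= negb_and.
have [pr|//] := boolP (root p (a / b)).
by rewrite (coprimep_root pq pr) orbT.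
by rewrite /root => ->.
Qed.

Lemma lift_mapZ c v : lift_map (vscale c v) = vscale (c ^+ d) (lift_map v).
Proof. by rewrite /lift_map !homogZ. Qed.

Lemma sphere_of_lift_map v : v != (0, 0) -> sphere_of (lift_map v) = rational_fun p q (sphere_of v).
Proof.
case: v => a b; rewrite /sphere_of /lift_map /rational_fun pqd xpair_eqE /=.
have [->|b0] := eqVneq b 0.
  rewrite andbT !homog_inf => a0; rewrite mulf_eq0 expf_eq0 (negPf a0) andbF orbF.
  by case: eqP => // _; rewrite invfM mulrACA divff ?mulr1 // expf_neq0.
move=> _; rewrite !homog_fin // mulf_eq0 expf_eq0 (negPf b0) andbF /=.
by case: eqP => // _; rewrite invfM mulrACA divff ?mul1r // expf_neq0.
Qed.

(** After dividing by the larger coordinate, the lower bound is the one for coprime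
    polynomials on the unit disc, for [p, q] or for their reversals. *)
Lemma lift_map_bounds : exists2 M : R, 1 <= M & forall v,
  vnorm v ^+ d <= M * vnorm (lift_map v) /\ vnorm (lift_map v) <= M * vnorm v ^+ d.
Proof.
have [c c0 Hc] := coprimep_lower_bound pq.
have pqr : coprimep (poly_rev d p) (poly_rev d q).
  apply: Pdiv.ClosedField.root_coprimep => x; rewrite /root !poly_revE => /eqP px.
  have := @lift_map_neq0 (1, x); rewrite /lift_map px !xpair_eqE oner_eq0 /= eqxx.
  exact.
have [c' c0' Hc'] := coprimep_lower_bound pqr.
have [K K0 HK] := poly_bounded p; have [L L0 HL] := poly_bounded q.
have [K' K0' HK'] := poly_bounded (poly_rev d p).
have [L' L0' HL'] := poly_bounded (poly_rev d q).
pose M := 1 + 2 ^+ d / c + 2 ^+ d / c' + K + L + K' + L'.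
have p2 : 0 < 2 ^+ d :> R by rewrite exprn_gt0.
have c1 : 0 < 2 ^+ d / c by rewrite divr_gt0.
have c1' : 0 < 2 ^+ d / c' by rewrite divr_gt0.
have main (s N F k l : R) : 0 <= s -> 0 < k -> s <= N -> N <= 2 * s -> F = s ^+ d * l ->
    k <= l -> l <= M -> 2 ^+ d / k <= M -> N ^+ d <= M * F /\ F <= M * N ^+ d.
  move=> s0 k0 sN Ns -> kl lM kM.
  have sd : 0 <= s ^+ d by rewrite exprn_ge0.
  have N0 : 0 <= N by apply: le_trans sN.
  split.
    apply: le_trans (_ : (2 * s) ^+ d <= _).
      by rewrite lerXn2r ?nnegrE ?mulr_ge0.
    rewrite exprMn mulrCA mulrC ler_wpM2l //.
    apply: le_trans (_ : 2 ^+ d / k * k <= _); first by rewrite divfK // gt_eqF.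
    by apply: ler_pM => //; [exact: ltW (divr_gt0 p2 k0)|exact: ltW].
  rewrite mulrC; apply: ler_pM => //; first by apply: le_trans kl; exact: ltW.
  by rewrite lerXn2r ?nnegrE.
have quot_le1 (a b : C) : cmod a <= cmod b -> cmod (a / b) <= 1.
  have [->|b0] := eqVneq b 0; first by rewrite invr0 mulr0 cmod0.
  by move=> ab; rewrite cmodM cmodV ler_pdivrMr ?cmod_gt0 // mul1r.
exists M; first by rewrite /M; lra.
case=> a b; have [ab|/ltW ba] := leP (cmod a) (cmod b).
  have x1 := quot_le1 _ _ ab.
  apply: (main (cmod b) _ _ c (cmod p.[a / b] + cmod q.[a / b])); rewrite ?cmod_ge0 //.
  - by rewrite /vnorm lerDr cmod_ge0.
  - by rewrite /vnorm /=; lra.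
  - have [b0|b0] := eqVneq b 0.
      have a0 : a = 0.
        by apply/eqP; rewrite -cmod_eq0 eq_le cmod_ge0 andbT (le_trans ab) // b0 cmod0.
      rewrite /lift_map /vnorm /= a0 b0 !homog_inf !expr0n cmod0.
      by rewrite (gtn_eqF (ltnW d2)) !mulr0 cmod0 expr0n (gtn_eqF (ltnW d2)) mul0r addr0.
    by rewrite /lift_map /vnorm /= !homog_fin // !cmodM cmodX mulrDr.
  - exact: Hc.
  - by rewrite /M; have := HK _ x1; have := HL _ x1; lra.
  - by rewrite /M; lra.
have x1 := quot_le1 _ _ ba.
apply: (main (cmod a) _ _ c' (cmod (poly_rev d p).[b / a] + cmod (poly_rev d q).[b / a])).
- exact: cmod_ge0.
- by [].
- by rewrite /vnorm lerDl cmod_ge0.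
- by rewrite /vnorm /=; lra.
- have [a0|a0] := eqVneq a 0.
    have b0 : b = 0.
      by apply/eqP; rewrite -cmod_eq0 eq_le cmod_ge0 andbT (le_trans ba) // a0 cmod0.
    rewrite /lift_map /vnorm /= a0 b0 !homog_inf !expr0n cmod0.
    by rewrite (gtn_eqF (ltnW d2)) !mulr0 cmod0 expr0n (gtn_eqF (ltnW d2)) mul0r addr0.
  have -> : (a, b) = vscale a (1, b / a) by rewrite /vscale /= mulr1 mulrCA divff ?mulr1.
  by rewrite lift_mapZ vnormZ cmodX !poly_revE.
- exact: Hc'.
- by rewrite /M; have := HK' _ x1; have := HL' _ x1; lra.
- by rewrite /M; lra.
Qed.

Lemma iter_lift_mapZ n c v :
  iter n lift_map (vscale c v) = vscale (c ^+ (d ^ n)) (iter n lift_map v).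
Proof.
elim: n => [|n IH]; first by rewrite expn0 expr1.
by rewrite !iterS IH lift_mapZ -exprM expnSr.
Qed.

Lemma iter_lift_map_neq0 n v : v != (0, 0) -> iter n lift_map v != (0, 0).
Proof. by move=> v0; elim: n => // n; rewrite iterS; exact: lift_map_neq0. Qed.

Lemma sphere_of_iter_lift_map n v : v != (0, 0) ->
  sphere_of (iter n lift_map v) = iter n (rational_fun p q) (sphere_of v).
Proof.
move=> v0; elim: n => // n IH.
by rewrite !iterS -IH sphere_of_lift_map // iter_lift_map_neq0.
Qed.

(** The constant is raised to the power [1 + d + ... + d^(n-1)], which is at most
    [d^n - 1] because [2 <= d]. *)
Lemma iter_lift_map_bounds : exists2 M : R, 1 <= M & forall n v,
  vnorm v ^+ (d ^ n) <= M ^+ (d ^ n) * vnorm (iter n lift_map v) /\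
  vnorm (iter n lift_map v) <= M ^+ (d ^ n) * vnorm v ^+ (d ^ n).
Proof.
have [M M1 HM] := lift_map_bounds; exists M => // n v.
have M0 : 0 <= M by apply: le_trans M1.
have dn k : (0 < d ^ k)%N by rewrite expn_gt0 (ltnW d2).
suff [H1 H2] : vnorm v ^+ (d ^ n) <= M ^+ (d ^ n).-1 * vnorm (iter n lift_map v) /\
  vnorm (iter n lift_map v) <= M ^+ (d ^ n).-1 * vnorm v ^+ (d ^ n).
  have Mp : M ^+ (d ^ n).-1 <= M ^+ (d ^ n) by rewrite ler_weXn2l // leq_pred.
  split; [apply: le_trans H1 _|apply: le_trans H2 _]; rewrite ler_wpM2r //.
    exact: vnorm_ge0.
  by rewrite exprn_ge0 ?vnorm_ge0.
elim: n => [|n [IH1 IH2]]; first by rewrite expn0 !expr1 expr0 !mul1r.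
have Me : M ^+ ((d ^ n).-1 * d) * M <= M ^+ (d ^ n.+1).-1.
  rewrite -exprSr ler_weXn2l // expnSr.
  by have := dn n; case: (d ^ n)%N => // k _; rewrite mulSn; lia.
have [B1 B2] := HM (iter n lift_map v).
rewrite iterS expnSr exprM; split.
  apply: le_trans (_ : (M ^+ (d ^ n).-1 * vnorm (iter n lift_map v)) ^+ d <= _).
    by rewrite lerXn2r ?nnegrE ?exprn_ge0 ?mulr_ge0 ?vnorm_ge0 ?exprn_ge0.
  rewrite exprMn -exprM.
  apply: le_trans (ler_wpM2l _ B1) _; first by rewrite exprn_ge0.
  by rewrite mulrA -expnSr ler_wpM2r ?vnorm_ge0.
apply: le_trans B2 _; rewrite -expnSr.
apply: le_trans (_ : M * (M ^+ (d ^ n).-1 * vnorm v ^+ (d ^ n)) ^+ d <= _).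
  by rewrite ler_wpM2l // lerXn2r ?nnegrE ?mulr_ge0 ?vnorm_ge0 ?exprn_ge0 ?vnorm_ge0.
rewrite exprMn -!exprM -expnSr mulrA [M * _]mulrC ler_wpM2r //.
by rewrite exprn_ge0 ?vnorm_ge0.
Qed.

End RationalLift.

(** * Local lifts of analytic maps to the sphere *)

Section LocalLift.
Variable R : realType.
Local Notation C := (Cplx R).

(** The lift is [(g, 1)] at a finite value and [(1, 1 / g)] at infinity. *)
Lemma sphere_derivable_lift (g : C -> sphere R) z : sphere_derivable g z ->
  exists v1 v2 : C -> C, [/\ hol v1 z, hol v2 z &
    \forall u \near z, (v1 u, v2 u) != (0, 0) /\ sphere_of (v1 u, v2 u) = g u].
Proof.
move=> [cg]; case gz: (g z) => [w|] dg.
  exists (@finite_coord R \o g), (fun=> 1); split.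
  - by constructor.
  - exact: hol_cst.
  have gw : nbhs (g z) [set x : sphere R | exists y, x = Some y].
    rewrite gz.
    have : \forall t \near w, exists y, Some t = Some y :> sphere R.
      by apply: filterE => t; exists t.
    exact.
  have near_gw : \forall u \near z, [set x : sphere R | exists y, x = Some y] (g u).
    exact: cg.
  apply: filterS near_gw => u [y gu]; rewrite /= gu /sphere_of /= oner_eq0 divr1; split=> //.
  by rewrite xpair_eqE oner_eq0 andbF.
exists (fun=> 1), (@infinity_coord R \o g); split.
- exact: hol_cst.
- by constructor.
have gw : nbhs (g z) [set x : sphere R | x <> Some 0].
  rewrite gz; exists [set 0].
    split; first exact: compact_set1.
    apply: accessible_closed_set1; apply: hausdorff_accessible; exact: norm_hausdorff.
  by move=> x [[y y0 <-]|-> //] [y0']; apply: y0.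
have near_gw : \forall u \near z, [set x : sphere R | x <> Some 0] (g u).
  exact: cg.
apply: filterS near_gw => u gu; rewrite /= xpair_eqE oner_eq0; split=> //.
case gu' : (g u) => [y|] /=; last by rewrite /sphere_of /= eqxx.
have y0 : y != 0 by apply: contra_not_neq gu => <-.
by rewrite /sphere_of /= invr_eq0 (negPf y0) invrK mul1r.
Qed.

Lemma hol_homog D (p : {poly C}) (v1 v2 : C -> C) z : hol v1 z -> hol v2 z ->
  hol (fun u => homog D p (v1 u, v2 u)) z.
Proof.
move=> h1 h2; apply: hol_sum => i.
apply: (@holM _ (fun u => p`_i * v1 u ^+ i) (fun u => v2 u ^+ (D - i))).
  by apply: (@holM _ (fun=> p`_i) (fun u => v1 u ^+ i)); [exact: hol_cst|exact: holX].
exact: holX.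
Qed.

Lemma hol_iter_lift_map p q d n (v1 v2 : C -> C) z : hol v1 z -> hol v2 z ->
  hol (fun u => (iter n (lift_map p q d) (v1 u, v2 u)).1) z /\
  hol (fun u => (iter n (lift_map p q d) (v1 u, v2 u)).2) z.
Proof.
move=> h1 h2; elim: n => [|n [IH1 IH2]]; first by split; [exact: h1|exact: h2].
set F := iter n (lift_map p q d) in IH1 IH2.
have H r : hol (fun u => homog d r (F (v1 u, v2 u))) z.
  have -> : (fun u => homog d r (F (v1 u, v2 u))) =
    (fun u => homog d r ((F (v1 u, v2 u)).1, (F (v1 u, v2 u)).2)).
    by apply/funext => u; rewrite -surjective_pairing.
  exact: (@hol_homog d r (fun u => (F (v1 u, v2 u)).1) (fun u => (F (v1 u, v2 u)).2) z IH1 IH2).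
by split; [exact: (H p)|exact: (H q)].
Qed.

(** [near_zero] and [near_infinity] define two open sets that cover the sphere; on
    each, one homogeneous coordinate is comparable to the norm. *)
Definition near_zero (x : sphere R) : bool :=
  if x is Some z then cmod z < 2 else false.

Definition near_infinity (x : sphere R) : bool :=
  if x is Some z then 1 / 2 < cmod z else true.

Lemma vnorm_near_zero v : near_zero (sphere_of v) -> vnorm v <= 3 * cmod v.2.
Proof.
rewrite /sphere_of; case: eqP => // /eqP v2 /=.
by rewrite cmodM cmodV ltr_pdivrMr ?cmod_gt0 // /vnorm; lra.
Qed.

Lemma vnorm_near_infinity v : near_infinity (sphere_of v) -> vnorm v <= 3 * cmod v.1.
Proof.
rewrite /sphere_of /vnorm; case: eqP => [/eqP v2|/eqP v2] /=.
  by move: v2; rewrite -cmod_eq0 => /eqP -> _; have := cmod_ge0 v.1; lra.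
by rewrite cmodM cmodV ltr_pdivlMr ?cmod_gt0 //; lra.
Qed.

End LocalLift.

(** * Rigidity of maps with controlled iterates *)

Section Core.
Variable R : realType.
Local Notation C := (Cplx R).

Variables (p q : {poly C}) (d : nat).
Hypotheses (pq : coprimep p q) (pqd : maxn (size p) (size q) = d.+1).
Hypothesis (d2 : (2 <= d)%N).
Let f := rational_fun p q.
Let F n := iter n (lift_map p q d).

(** A bound on the oscillation of [h] at scale [delta]; it does not refer to any
    derivative, so that it survives perturbations of [h]. *)
Definition small_patches (h : C -> sphere R) (r delta : R) := forall z0,
  csquare 0 r z0 ->
  (forall z, csquare z0 delta z -> near_zero (h z)) \/
  (forall z, csquare z0 delta z -> near_infinity (h z)).

(** The function [u] of the introduction.  The exponent of [|z|] is one less than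
    that of the wedge, so that the quotient stays holomorphic at 0. *)
Let potential n (w v : C * C) (z : C) : R :=
  cmod (wedge v w) ^+ (d ^ n) / vnorm (F n v) / cmod z ^+ (d ^ n).-1.

Let expn_ge2 n : (0 < n)%N -> exists N, (d ^ n = N.+2)%N.
Proof.
move=> n0; have : (2 <= d ^ n)%N.
  by apply: leq_trans d2 _; rewrite -{1}[d]expn1 leq_exp2l.
by case: (d ^ n)%N => [|[|N]] // _; exists N.
Qed.

(** Replace the norm of [F n v] by its coordinate that is comparable to it on the
    patch, and drop the moduli.  The quotient is homogeneous of degree 0 in [v], so it
    can be computed with any local holomorphic lift of [g]. *)
Lemma potential_patch n (g : C -> sphere R) (z0 : C) delta : (0 < n)%N ->
  (forall z, sphere_derivable g z) ->
  ((forall z, csquare z0 delta z -> near_zero (iter n f (g z))) \/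
   (forall z, csquare z0 delta z -> near_infinity (iter n f (g z)))) ->
  exists m : C -> C, forall z, csquare z0 delta z ->
    hol m z /\
    potential n (std_lift (g 0)) (std_lift (g z)) z <= cmod (m z) <=
      3 * potential n (std_lift (g 0)) (std_lift (g z)) z.
Proof.
move=> n0 dg hh; set w := std_lift (g 0).
have [N dN] := expn_ge2 n0.
have [pick [pick_hol pick_le pickZ]] : exists pick : C * C -> C,
    [/\ forall v1 v2 z, hol v1 z -> hol v2 z -> hol (fun u => pick (F n (v1 u, v2 u))) z,
        forall z, csquare z0 delta z -> forall v, v != (0, 0) -> sphere_of v = g z ->
          [/\ pick (F n v) != 0, cmod (pick (F n v)) <= vnorm (F n v) &
              vnorm (F n v) <= 3 * cmod (pick (F n v))] &
        forall c v, pick (vscale c v) = c * pick v].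
  case: hh => hh.
    exists snd; split => //.
      by move=> v1 v2 z h1 h2; have [_ H] := hol_iter_lift_map p q d n h1 h2; exact: H.
    move=> z /hh gz v v0 vg; have Fv0 := iter_lift_map_neq0 pq pqd n v0.
    have H3 : vnorm (F n v) <= 3 * cmod (F n v).2.
      by apply: vnorm_near_zero; rewrite /F (sphere_of_iter_lift_map pq pqd) // vg.
    have : 0 < vnorm (F n v) by rewrite vnorm_gt0.
    split=> //; last by rewrite /vnorm lerDr cmod_ge0.
    by rewrite -cmod_gt0; lra.
  exists fst; split => //.
    by move=> v1 v2 z h1 h2; have [H _] := hol_iter_lift_map p q d n h1 h2; exact: H.
  move=> z /hh gz v v0 vg; have Fv0 := iter_lift_map_neq0 pq pqd n v0.
  have H3 : vnorm (F n v) <= 3 * cmod (F n v).1.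
    by apply: vnorm_near_infinity; rewrite /F (sphere_of_iter_lift_map pq pqd) // vg.
  have : 0 < vnorm (F n v) by rewrite vnorm_gt0.
  split=> //; last by rewrite /vnorm lerDl cmod_ge0.
  by rewrite -cmod_gt0; lra.
pose q' v z := wedge v w ^+ N.+2 / z ^+ N.+1 / pick (F n v).
have qZ c v z : c != 0 -> q' (vscale c v) z = q' v z.
  move=> c0; rewrite /q' wedgeZ /F iter_lift_mapZ pickZ dN exprMn.
  have cN : c ^+ N.+2 != 0 by rewrite expf_neq0.
  have cancel_cN (a b e : C) : c ^+ N.+2 * a * b * ((c ^+ N.+2)^-1 * e) = a * b * e.
    by move: cN; move: (c ^+ _) => x x0; field.
  by rewrite invfM cancel_cN.
exists (fun z => q' (std_lift (g z)) z) => z zd.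
have [P0 P1 P2] := pick_le z zd _ (std_lift_neq0 (g z)) (sphere_of_std_lift (g z)).
split; last first.
  have cmodE (a b e : C) :
      cmod (a ^+ N.+2 / b ^+ N.+1 / e) = cmod a ^+ N.+2 / cmod b ^+ N.+1 / cmod e.
    by rewrite cmodM cmodV (cmodM (_ ^+ _)) cmodV !cmodX.
  rewrite /q' /potential dN -[N.+2.-1]/(N.+1) cmodE.
  set a := cmod (wedge _ _) ^+ _; set b := cmod z ^+ _.
  have a0 : 0 <= a / b by rewrite divr_ge0 // exprn_ge0 // cmod_ge0.
  have pk0 : 0 < cmod (pick (F n (std_lift (g z)))) by rewrite cmod_gt0.
  have Fv0 : 0 < vnorm (F n (std_lift (g z))) by lra.
  rewrite ![a / _ / b]mulrAC [3 * _]mulrCA.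
  apply/andP; split; apply: ler_wpM2l => //; first by rewrite lef_pV2 // posrE.
  rewrite -[X in _ <= X]invrK invfM invrK lef_pV2 ?posrE ?mulr_gt0 ?invr_gt0 //.
  by rewrite ler_pdivrMl.
have [v1 [v2 [h1 h2 near_v]]] := sphere_derivable_lift (dg z).
have hloc : hol (fun u => q' (v1 u, v2 u) u) z.
  have [v0 vg] := nbhs_singleton near_v.
  have [p0 _ _] := pick_le z zd _ v0 vg.
  have he : hol (fun u => wedge (v1 u, v2 u) w) z.
    apply: (@holB _ (fun u => v1 u * w.2) (fun u => v2 u * w.1)).
      by apply: (@holM _ v1 (fun=> w.2)); [exact: h1|exact: hol_cst].
    by apply: (@holM _ v2 (fun=> w.1)); [exact: h2|exact: hol_cst].
  apply: (@holM _ (fun u => wedge (v1 u, v2 u) w ^+ N.+2 / u ^+ N.+1)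
     (fun u => (pick (F n (v1 u, v2 u)))^-1)); last first.
    by apply: (@holV _ (fun u => pick (F n (v1 u, v2 u)))); [exact: p0|exact: pick_hol].
  (* at 0 the wedge vanishes, which compensates the pole of the denominator *)
  have [z00|z00] := eqVneq z 0.
    have e0 : wedge (v1 z, v2 z) w = 0.
      have [] := sphere_of_inj v0 (std_lift_neq0 (g 0)).
        by rewrite vg z00 sphere_of_std_lift.
      by move=> c _ ->; rewrite wedgeZ wedgexx mulr0.
    have := hol_divX N he e0.
    by rewrite z00; under [X in hol X]eq_fun do rewrite subr0.
  apply: (@holM _ (fun u => wedge (v1 u, v2 u) w ^+ N.+2) (fun u => (u ^+ N.+1)^-1)).
    exact: (@holX _ (fun u => wedge (v1 u, v2 u) w)).
  apply: (@holV _ (fun u => u ^+ N.+1)); first by rewrite expf_neq0.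
  by apply: (@holX _ id); exact: hol_id.
apply: hol_near hloc; apply: filterS near_v => u [v0 vg].
have [c c0 ->] := sphere_of_inj v0 (std_lift_neq0 (g u))
  (eq_trans vg (esym (sphere_of_std_lift (g u)))).
exact: qZ.
Qed.

Lemma potential_ge0 n w v z : 0 <= potential n w v z.
Proof. by rewrite !divr_ge0 ?exprn_ge0 ?cmod_ge0 ?vnorm_ge0. Qed.

Lemma potential_le (M : R) n w v z (b : R) :
  (forall v, vnorm v ^+ (d ^ n) <= M ^+ (d ^ n) * vnorm (F n v)) ->
  v != (0, 0) -> 0 < b -> b <= cmod z ->
  potential n w v z <= (M * vnorm w) ^+ (d ^ n) / b ^+ (d ^ n).-1.
Proof.
move=> HM v0 b0 bz; have vF : 0 < vnorm (F n v).
  by rewrite vnorm_gt0 (iter_lift_map_neq0 pq pqd).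
rewrite /potential; apply: ler_pM.
- by rewrite divr_ge0 ?exprn_ge0 ?cmod_ge0 ?vnorm_ge0.
- by rewrite invr_ge0 exprn_ge0 ?cmod_ge0.
- rewrite ler_pdivrMr //.
  apply: le_trans (_ : (vnorm v * vnorm w) ^+ (d ^ n) <= _).
    by rewrite lerXn2r ?nnegrE ?cmod_ge0 ?mulr_ge0 ?vnorm_ge0 // wedge_le.
  rewrite !exprMn mulrAC ler_wpM2r ?exprn_ge0 ?vnorm_ge0 //.
rewrite lef_pV2 ?posrE ?exprn_gt0 // ?(lt_le_trans b0) //.
by rewrite lerXn2r ?nnegrE ?cmod_ge0 // ltW.
Qed.

(** Quantitative form of the fact that [g] is constant if the maps [f^n \o g] are
    equicontinuous on every compact subset of the plane, uniformly in [n]: the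
    square of half-side [r] is fixed first, then the oscillation scale [delta] of the
    iterates, and [n] last.  Raising the estimate of [u] to the power [1 / N] makes
    the constant of the barrier harmless. *)
Lemma iterates_rigid (eta R1 : R) : 0 < eta -> 0 < R1 ->
  exists2 r : R, 0 < r & forall delta, 0 < delta -> exists n0, forall n g,
    (n0 <= n)%N -> (forall z, sphere_derivable g z) ->
    small_patches (iter n f \o g) r delta ->
    forall z, cmod z <= R1 ->
      cmod (wedge (std_lift (g z)) (std_lift (g 0))) <
        eta * (vnorm (std_lift (g z)) * vnorm (std_lift (g 0))).
Proof.
move=> eta0 R10; have [M M1 HM] := iter_lift_map_bounds pq pqd d2.
have M0 : 0 < M by apply: lt_le_trans M1.
pose c := eta / M ^+ 2.
have c0 : 0 < c by rewrite divr_gt0 // exprn_gt0.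
(* [2 * R1 / r = rho] is so small that [rho ^ (N - 1) <= (c / 2) ^ N] if [N >= 2] *)
pose rho := Num.min 1 ((c / 2) ^+ 2).
have rho0 : 0 < rho by rewrite lt_min ltr01 exprn_gt0 // divr_gt0.
have rho1 : rho <= 1 by rewrite ge_min lexx.
pose r := 2 * R1 / rho.
have r0 : 0 < r by rewrite divr_gt0 // mulr_gt0.
have R1r : R1 <= r / 2 by rewrite /r ler_pdivlMr // ler_pdivlMr //; nra.
exists r => // delta0 delta00; pose delta := Num.min delta0 (r / 2).
have del0 : 0 < delta by rewrite lt_min delta00 divr_gt0.
have delr : delta <= r / 2 by rewrite ge_min lexx orbT.
have [B B0 HB] := barrier_bound r del0.
have [n1 Bn1] : exists n1 : nat, B < n1%:R.
  by exists (Num.bound B); apply: archi_boundP; exact: ltW.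
exists n1.+1 => n g nn dg patches z1 z1R.
have n0 : (0 < n)%N by apply: leq_trans nn.
set w := std_lift (g 0).
pose u z := potential n w (std_lift (g z)) z.
have patch z0 : csquare 0 (r - delta) z0 -> exists m : C -> C,
    forall z, csquare z0 delta z -> hol m z /\ u z <= cmod (m z) <= 3 * u z.
  move=> z0r; apply: (@potential_patch n g z0 delta n0 dg).
  have sub z : csquare z0 delta z -> csquare z0 delta0 z.
    have : delta <= delta0 by rewrite ge_min lexx.
    by rewrite /csquare => dd /andP[H1 H2]; rewrite (le_trans H1 dd) (le_trans H2 dd).
  have z0r' : csquare 0 r z0.
    by apply: csquareD z0r _; rewrite /csquare subrr /= normr0 ltW.
  by case: (patches z0 z0r') => H; [left|right] => z /sub/H.
pose Y := (M * vnorm w) ^+ (d ^ n) / (r / 2) ^+ (d ^ n).-1.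
have Y0 : 0 <= Y.
  apply: divr_ge0; apply: exprn_ge0; last by rewrite ltW // divr_gt0.
  by apply: mulr_ge0; [exact: ltW|exact: vnorm_ge0].
have uY z : ~~ csquare 0 (r - delta) z -> u z <= Y.
  move=> zn; apply: potential_le.
  - by move=> v; have [] := HM n v.
  - exact: std_lift_neq0.
  - by rewrite divr_gt0.
  have dr : r / 2 <= r - delta by lra.
  apply: le_trans dr _; move: zn; rewrite /csquare subr0 negb_and -!ltNge.
  move=> /orP[] /ltW H; apply: (le_trans H); [exact: Re_le_cmod|exact: Im_le_cmod].
(* near 0 the bound comes from a patch, elsewhere from [potential_le] *)
have [Mu HMu] : exists Mu, forall z, u z <= Mu.
  have zin : csquare 0 (r - delta) 0 by rewrite /csquare subr0 /= normr0; lra.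
  have [m Hm] := patch 0 zin.
  have z00 : csquare 0 delta 0 by rewrite /csquare subr0 /= normr0; lra.
  have [hm _] := Hm 0 z00.
  have /hol_continuous/cvgr_dist_lt/(_ 1%:C) := hm.
  rewrite ltcR ltr01 => /(_ isT)/nearCP[e e0 He].
  pose e' := Num.min e delta.
  have e'0 : 0 < e' by rewrite lt_min e0.
  exists (Num.max (cmod (m 0) + 1) ((M * vnorm w) ^+ (d ^ n) / e' ^+ (d ^ n).-1)) => z.
  rewrite le_max; have [ze|ze] := ltP (cmod z) e'; last first.
    apply/orP; right; apply: potential_le => //; last exact: std_lift_neq0.
    by move=> v; have [] := HM n v.
  apply/orP; left; move: ze; rewrite lt_min => /andP[ze zd].
  have zin' : csquare 0 delta z.
    rewrite /csquare subr0; apply/andP; split; apply: ltW; apply: le_lt_trans zd.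
      exact: Re_le_cmod.
    exact: Im_le_cmod.
  have [_ /andP[um _]] := Hm z zin'; apply: le_trans um _.
  have : `|m 0 - m z| < 1%:C by apply: He; rewrite subr0.
  rewrite normC_cmod ltcR => H.
  have := cmod_dist (m z) (m 0); rewrite cmodBC; lra.
have z1r : csquare 0 r z1.
  have zr : cmod z1 <= r by lra.
  rewrite /csquare subr0; apply/andP; split; apply: le_trans zr.
    exact: Re_le_cmod.
  exact: Im_le_cmod.
have Hu : u z1 <= Y * B.
  apply: (HB u Y Mu) => // [z|z _]; first exact: potential_ge0.
  exact: uY.
set v := std_lift (g z1).
have v0 : 0 < vnorm v by rewrite vnorm_gt0 std_lift_neq0.
have w0 : 0 < vnorm w by rewrite vnorm_gt0 std_lift_neq0.
rewrite ltNge; apply/negP => big.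
have z10 : z1 != 0.
  apply: contra_notN (negP (_ : ~~ (eta * (vnorm v * vnorm w) <= 0))) => [/eqP z10|].
    by move: big; rewrite /v z10 wedgexx cmod0.
  by rewrite -ltNge !mulr_gt0.
pose N := (d ^ n)%N.
have [N' NE] : exists N', N = N'.+2 := expn_ge2 n0.
have Nn : (n1 < N)%N.
  by rewrite /N (leq_trans nn) // ltnW // ltn_expl.
have Fv0 : 0 < vnorm (F n v) by rewrite vnorm_gt0 (iter_lift_map_neq0 pq pqd) // std_lift_neq0.
have cz : 0 < cmod z1 by rewrite cmod_gt0.
have E1 : cmod (wedge v w) ^+ N <= Y * B * (M ^+ N * vnorm v ^+ N * R1 ^+ N'.+1).
  have -> : cmod (wedge v w) ^+ N = u z1 * (vnorm (F n v) * cmod z1 ^+ N'.+1).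
    rewrite /u /potential -/v -/N NE -[N'.+2.-1]/(N'.+1).
    by field; rewrite !gt_eqF // exprn_gt0.
  apply: ler_pM => //; first exact: potential_ge0.
    by rewrite mulr_ge0 ?vnorm_ge0 // exprn_ge0 // cmod_ge0.
  apply: ler_pM; rewrite ?vnorm_ge0 ?exprn_ge0 ?cmod_ge0 //.
    by have [] := HM n v.
  by rewrite lerXn2r ?nnegrE ?cmod_ge0 // ltW.
have E2 : (eta * (vnorm v * vnorm w)) ^+ N <= cmod (wedge v w) ^+ N.
  by rewrite lerXn2r ?nnegrE ?cmod_ge0 // !mulr_ge0 // ltW.
have {E1 E2} E := le_trans E2 E1.
have E3 : c ^+ N <= B * rho ^+ N'.+1.
  have pos : 0 < (M ^+ 2) ^+ N * (vnorm v * vnorm w) ^+ N.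
    by rewrite mulr_gt0 // exprn_gt0 // ?mulr_gt0 // exprn_gt0.
  rewrite -(ler_pM2r pos).
  have -> : c ^+ N * ((M ^+ 2) ^+ N * (vnorm v * vnorm w) ^+ N) =
      (eta * (vnorm v * vnorm w)) ^+ N.
    by rewrite -!exprMn; congr (_ ^+ N); rewrite /c; field; rewrite gt_eqF.
  apply: le_trans E _; rewrite le_eqVlt; apply/orP; left; apply/eqP.
  rewrite /Y -/N NE -[N'.+2.-1]/(N'.+1) -NE.
  have -> : rho = R1 / (r / 2) by rewrite /r; field; rewrite !gt_eqF.
  have -> : (M ^+ 2) ^+ N = M ^+ N * M ^+ N by rewrite expr2 exprMn.
  have t0 : r / 2 != 0 by rewrite gt_eqF // divr_gt0.
  move: t0; move: (r / 2) => t t0.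
  by rewrite !exprMn exprVn; field; rewrite expf_neq0.
have E4 : rho ^+ N'.+1 <= (c / 2) ^+ N.
  have rr0 : 0 <= rho ^+ N'.+1 by rewrite exprn_ge0 // ltW.
  have cc0 : 0 <= (c / 2) ^+ N by rewrite exprn_ge0 // ltW // divr_gt0.
  rewrite -ler_sqr ?nnegrE //.
  rewrite -!exprM [X in _ <= _ ^+ X]mulnC [X in _ <= X]exprM.
  apply: le_trans (_ : rho ^+ N <= _).
    by apply: ler_wiXn2l => //; [exact: ltW|rewrite NE muln2 -addnn addSn addnS !ltnS leq_addr].
  apply: lerXn2r; rewrite ?nnegrE; first exact: ltW.
    by rewrite exprn_ge0 // ltW // divr_gt0.
  by rewrite /rho ge_min lexx orbT.
have E5 : c ^+ N <= B * (c / 2) ^+ N.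
  by apply: le_trans E3 _; apply: ler_wpM2l => //; exact: ltW.
have E6 : 2 ^+ N <= B.
  have cN : 0 < c ^+ N by rewrite exprn_gt0.
  have tN : 0 < 2 ^+ N :> R by rewrite exprn_gt0.
  move: E5; rewrite [(c / 2) ^+ N]expr_div_n (mulrA B) ler_pdivlMr // mulrC => E5.
  by rewrite -(ler_pM2r cN).
have : n1%:R <= 2 ^+ N :> R.
  by rewrite -natrX ler_nat ltnW // (leq_trans Nn) // ltnW // ltn_expl.
by rewrite leNgt (le_lt_trans E6).
Qed.

End Core.

(** * Neighbourhoods on the sphere *)

Section SphereTopology.
Variable R : realType.
Local Notation C := (Cplx R).
Implicit Types (x y : sphere R) (z : C).

Lemma compact_csquare (r : R) : compact [set z : C | csquare 0 r z].
Proof.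
pose h (xy : R * R) : C := xy.1 +i* xy.2.
have ch : continuous h.
  case=> a b; apply/cvgrPdist_lt => e /= e0.
  have [e' e'0 ->] : exists2 e' : R, 0 < e' & e = e'%:C.
    have re : e = (complex.Re e)%:C by apply/esym/RRe_real/ger0_real/ltW.
    by exists (complex.Re e) => //; rewrite -ltcR -re.
  have e2 : 0 < e' / 2 by rewrite divr_gt0.
  exists (ball a (e' / 2), ball b (e' / 2)); first by split; exact: nbhsx_ballx.
  case=> c d' [/= H1 H2]; rewrite normC_cmod ltcR.
  apply: le_lt_trans (cmod_le_ReIm _) _ => /=.
  by rewrite /ball /= in H1 H2; lra.
suff -> : [set z : C | csquare 0 r z] = h @` (`[- r, r] `*` `[- r, r]).
  apply: continuous_compact; first exact: continuous_subspaceT.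
  by apply: compact_setX; exact: segment_compact.
apply/seteqP; split=> [[a b]|z [[a b] /= [H1 H2] <-]].
  rewrite /= /csquare subr0 /= !ler_norml => /andP[H1 H2].
  by exists (a, b) => //=; rewrite !in_itv.
by move: H1 H2; rewrite /csquare subr0 /= !in_itv /= !ler_norml => -> ->.
Qed.

Definition beyond (r : R) x : bool := if x is Some z then r < cmod z else true.

Lemma nbhs_infinity (r : R) : nbhs (None : sphere R) [set x | beyond r x].
Proof.
exists [set z | csquare 0 `|r| z]; first split.
- exact: compact_csquare.
- apply: compact_closed; last exact: compact_csquare.
  exact: norm_hausdorff.
move=> x [[z nz <-]|->] //=; move/negP: nz.
have := ler_norm r.
rewrite /csquare subr0 negb_and -!ltNge => rr /orP[] H.
  by apply: le_lt_trans rr _; apply: lt_le_trans H (Re_le_cmod _).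
by apply: le_lt_trans rr _; apply: lt_le_trans H (Im_le_cmod _).
Qed.

Lemma nbhs_finite (z : C) (P : set (sphere R)) (e : R) : 0 < e ->
  (forall w, cmod (w - z) < e -> P (Some w)) -> nbhs (Some z : sphere R) P.
Proof.
move=> e0 H; have : \forall w \near z, P (Some w) by apply/nearCP; exists e.
exact.
Qed.

Lemma nbhs_near_zero x : near_zero x -> nbhs x [set y | near_zero y].
Proof.
case: x => [z|//] /= z2; apply: (@nbhs_finite _ _ (2 - cmod z)); first by rewrite subr_gt0.
by move=> w wz /=; have := cmod_dist w z; lra.
Qed.

Lemma nbhs_near_infinity x : near_infinity x -> nbhs x [set y | near_infinity y].
Proof.
case: x => [z|_] /=; last first.
  by apply: filterS (nbhs_infinity (1 / 2)) => -[].
move=> z2; apply: (@nbhs_finite _ _ (cmod z - 1 / 2)); first by rewrite subr_gt0.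
by move=> w wz /=; have := cmod_dist z w; rewrite cmodBC; lra.
Qed.

Lemma near_zero_or_infinity x : near_zero x || near_infinity x.
Proof.
case: x => [z|//] /=; apply/orP.
by have [|] := ltP (cmod z) 2; [left|right => //; lra].
Qed.

(** Lower semicontinuity of the chordal distance, checked in the two charts. *)
Lemma sphere_separation x0 x1 : x0 <> x1 ->
  exists2 eta : R, 0 < eta & exists O0 O1, [/\ nbhs x0 O0, nbhs x1 O1 &
    forall x y, O0 x -> O1 y ->
      eta * (vnorm (std_lift y) * vnorm (std_lift x)) <=
      cmod (wedge (std_lift y) (std_lift x))].
Proof.
have finite_infinite (a : C) : exists2 eta : R, 0 < eta & exists O0 O1,
    [/\ nbhs (Some a : sphere R) O0, nbhs (None : sphere R) O1 &
    forall x y, O0 x -> O1 y ->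
      eta * (vnorm (std_lift y) * vnorm (std_lift x)) <=
      cmod (wedge (std_lift y) (std_lift x))].
  pose K := cmod a + 2; have K0 : 0 < K by have := cmod_ge0 a; rewrite /K; lra.
  exists (1 / (3 * K)); first by rewrite divr_gt0 // mulr_gt0.
  exists [set x : sphere R | if x is Some z then cmod (z - a) < 1 else False].
  exists [set y | beyond (2 * K) y].
  split; first exact: (@nbhs_finite _ _ 1).
    exact: nbhs_infinity.
  case=> [x|//] y xa yK.
  have xK : cmod x + 1 < K by move: xa => /= xa; have := cmod_dist x a; rewrite /K; lra.
  rewrite mulrC mulrA mulr1 ler_pdivrMr ?mulr_gt0 //.
  case: y yK => [y /= yK|_] /=.
    rewrite /vnorm /wedge /= mulr1 mul1r cmod1.
    have y0 := cmod_ge0 y.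
    apply: le_trans (_ : (cmod y + 1) * K <= _).
      by apply: ler_wpM2l; [rewrite addr_ge0|exact: ltW].
    rewrite mulrA; apply: ler_wpM2r; first exact: ltW.
    by have := cmod_dist y x; lra.
  rewrite /vnorm /wedge /= mulr1 mul0r subr0 cmod1 cmod0.
  rewrite /K in xK K0 *; lra.
case: x0 => [a|]; case: x1 => [b|] ab //; last first.
  have [k k0 [N0 [N1 [HO HI H]]]] := finite_infinite b.
  exists k => //; exists N1, N0; split=> // x y Ox Oy.
  by rewrite wedge_sym [X in k * X]mulrC; exact: H.
have ab0 : 0 < cmod (a - b).
  by rewrite cmod_gt0 subr_eq0; apply: contra_not_neq ab => ->.
pose e := cmod (a - b) / 4; have e0 : 0 < e by rewrite divr_gt0.
pose Ka := cmod a + e + 1; pose Kb := cmod b + e + 1.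
have Ka0 : 0 < Ka by have := cmod_ge0 a; rewrite /Ka; lra.
have Kb0 : 0 < Kb by have := cmod_ge0 b; rewrite /Kb; lra.
exists (2 * e / (Kb * Ka)); first by rewrite divr_gt0 // mulr_gt0.
exists [set x | if x is Some z then cmod (z - a) < e else False].
exists [set x | if x is Some z then cmod (z - b) < e else False].
split; [exact: (@nbhs_finite _ _ e)|exact: (@nbhs_finite _ _ e)|].
case=> [x|//] [y|//] /= xa yb.
rewrite mulrAC ler_pdivrMr ?mulr_gt0 //.
rewrite /wedge /= mulr1 mul1r.
apply: ler_pM.
+ by rewrite !mulr_ge0 // ltW.
+ by rewrite mulr_ge0 ?vnorm_ge0.
+ have := cmod_dist (a - b) ((a - x) + (y - b)).
  have -> : a - b - (a - x + (y - b)) = - (y - x) by ring.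
  have := cmodD (a - x) (y - b); rewrite cmodN (cmodBC a x).
  have : cmod (a - b) = 4 * e by rewrite /e; field.
  lra.
apply: ler_pM; rewrite ?vnorm_ge0 // /vnorm /= cmod1.
  by have := cmod_dist y b; rewrite /Kb; lra.
by have := cmod_dist x a; rewrite /Ka; lra.
Qed.

End SphereTopology.

(** * Two elementary principles *)

Lemma unit_interval_chain (R : realType) (P : R -> Prop) : P 0 ->
  (forall x, 0 <= x <= 1 -> exists2 e, 0 < e &
     forall s t, 0 <= s <= 1 -> 0 <= t <= 1 ->
       `|s - x| < e -> `|t - x| < e -> P s -> P t) ->
  P 1.
Proof.
move=> P0 step.
pose S := [set x | 0 <= x <= 1 /\ P x].
have S0 : S 0 by split; rewrite ?lexx ?ler01.
have Sub : has_ubound S by exists 1 => x [/andP[]].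
have hS : has_sup S by split => //; exists 0.
pose s := sup S.
have s01 : 0 <= s <= 1.
  apply/andP; split; first exact: ub_le_sup.
  by apply: ge_sup; [exists 0|move=> x [/andP[]]].
have [e e0 He] := step _ s01.
have [x [x01 Px] xs] := sup_adherent e0 hS.
have xs' : x <= s by apply: ub_le_sup.
have good t : 0 <= t <= 1 -> `|t - s| < e -> P t.
  move=> t01 ts; apply: (He x t) => //.
  by rewrite ltr_norml; rewrite -/s in xs; lra.
have [s1|s1] := ltP s 1; last first.
  have -> : 1 = s by apply/eqP; rewrite eq_le s1; case/andP: s01.
  by apply: good => //; rewrite subrr normr0.
pose t := Num.min 1 (s + e / 2).
have t01 : 0 <= t <= 1.
  rewrite ge_min lexx /= andbT le_min ler01 /=; case/andP: s01; lra.
have ts : s < t by rewrite lt_min s1 /=; lra.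
have tse : t <= s + e / 2 by rewrite ge_min lexx orbT.
have Pt : P t by apply: good => //; rewrite ltr_norml; lra.
by have : t <= s by [apply: ub_le_sup]; rewrite leNgt ts.
Qed.

Lemma finite_repeat (G : finType) (Q : nat -> G -> Prop) :
  (forall l, (l <= #|G|)%N -> exists g, Q l g) ->
  exists l m g, [/\ (l < m <= #|G|)%N, Q l g & Q m g].
Proof.
move=> H.
have /choice[k Hk] : forall l : 'I_(#|G|.+1), exists g, Q l g.
  by move=> l; apply: H; rewrite -ltnS.
have : ~~ injectiveb k.
  apply/negP => /injectiveP/leq_card; rewrite card_ord ltnn //.
case/injectivePn => l [m lm klm].
have [ltlm|ltml|/val_inj E] := ltngtP l m; last by rewrite E eqxx in lm.
- by exists l, m, (k l); split; [rewrite ltlm -ltnS /=|exact: Hk|rewrite klm; exact: Hk].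
- by exists m, l, (k l); split; [rewrite ltml -ltnS /=|rewrite klm; exact: Hk|exact: Hk].
Qed.

(** * Orbifold boxes *)

Section Boxes.
Variable R : realType.
Local Notation C := (Cplx R).

Lemma nbhs_slab (T : topologicalType) (t : T) (w : C) (P : set (T * C)) :
  nbhs (t, w) P <-> exists S (r : R), [/\ nbhs t S, 0 < r &
    forall t' w', S t' -> cmod (w' - w) < r -> P (t', w')].
Proof.
split=> [[[S W] /= [tS /nearCP[r r0 rW]] SW]|[S [r [tS r0 SP]]]].
  by exists S, r; split=> // t' w' St' w'w; apply: SW; split=> //=; exact: rW.
exists (S, [set w' | cmod (w' - w) < r]); first by split=> //; exact: near_cmod.
by case=> t' w' [/= ? ?]; exact: SP.
Qed.

(** Joint continuity of the affine reparametrization [(s, w, al, u) |-> (s, w + al u)]. *)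
Lemma nbhs_shift (T : topologicalType) (s : T) (w al u0 : C) (P : set (T * C)) :
  nbhs (s, w + al * u0) P ->
  exists M (e : R), [/\ nbhs (s, w) M, 0 < e &
    forall s' w' al' u, M (s', w') -> cmod (al' - al) < e -> cmod (u - u0) < e ->
      P (s', w' + al' * u)].
Proof.
move=> /nbhs_slab[S [r [sS r0 SP]]].
have a1 : 0 < cmod al + 1 by rewrite ltr_wpDl ?cmod_ge0.
have u1 : 0 < cmod u0 + 1 by rewrite ltr_wpDl ?cmod_ge0.
pose e := Num.min 1 (Num.min (r / (4 * (cmod al + 1))) (r / (4 * (cmod u0 + 1)))).
have e0 : 0 < e by rewrite !lt_min ltr01 !divr_gt0 // mulr_gt0.
have e1 : e <= 1 by rewrite ge_min lexx.
have ea : e * (cmod al + 1) <= r / 4.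
  have : e <= r / (4 * (cmod al + 1)) by rewrite !ge_min lexx orbT.
  rewrite ler_pdivlMr ?mulr_gt0 //; lra.
have eu : e * (cmod u0 + 1) <= r / 4.
  have : e <= r / (4 * (cmod u0 + 1)) by rewrite !ge_min lexx !orbT.
  rewrite ler_pdivlMr ?mulr_gt0 //; lra.
exists [set y | S y.1 /\ cmod (y.2 - w) < r / 4], e; split => //.
  by apply/nbhs_slab; exists S, (r / 4); split=> //; rewrite divr_gt0.
move=> s' w' al' u /= [Ss' w'w] ale ue; apply: SP => //.
have -> : w' + al' * u - (w + al * u0) =
  (w' - w) + ((al' - al) * u0 + al' * (u - u0)) by ring.
apply: le_lt_trans (cmodD _ _) _.
apply: le_lt_trans (lerD (lexx _) (cmodD _ _)) _; rewrite !cmodM.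
have al'1 : cmod al' <= cmod al + 1 by have := cmod_dist al' al; lra.
have H1 : cmod (al' - al) * cmod u0 <= r / 4.
  apply: le_trans eu; apply: ler_pM; rewrite ?cmod_ge0 ?lerDl //; exact: ltW.
have H2 : cmod al' * cmod (u - u0) <= r / 4.
  apply: le_trans ea; rewrite [e * _]mulrC.
  by apply: ler_pM; rewrite ?cmod_ge0 //; exact: ltW.
lra.
Qed.

Variables (A : topologicalType) (o : orbifold_box R A).
Notation T := (box_trans o).
Notation D := (box_dom o).

Lemma box_dom_near (z : C) : D z -> exists2 r : R, 0 < r &
  forall w, cmod (w - z) < r -> D w.
Proof.
move=> Dz; have [oD _ _] := box_domain o.
by apply/nearCP; exact: open_nbhs_nbhs.
Qed.

Lemma slab_open : open ([set: T] `*` D).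
Proof.
rewrite openE => -[t z] [_ /box_dom_near[r r0 rD]].
suff : nbhs (t, z) ([set: T] `*` D) by [].
apply/nbhs_slab; exists setT, r; split=> //; first exact: filterT.
by move=> t' w' _ /rD; split.
Qed.

Lemma box_chart_cts t z : D z -> {for (t, z), continuous (box_chart o)}.
Proof.
move=> Dz; have := @box_chart_continuous R A o.
rewrite continuous_open_subspace; last exact: slab_open.
by apply; rewrite inE; split.
Qed.

Lemma box_act_cts g t z : D z -> {for (t, z), continuous (box_act o g)}.
Proof.
move=> Dz; have := @box_act_continuous R A o g.
rewrite continuous_open_subspace; last exact: slab_open.
by apply; rewrite inE; split.
Qed.

Lemma box_chart_image_nbhs t z (N : set (T * C)) : D z -> nbhs (t, z) N ->
  nbhs (box_chart o (t, z)) [set x | exists y, [/\ N y, D y.2 & box_chart o y = x]].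
Proof.
move=> Dz nN.
have nND : nbhs (t, z) (N `&` ([set: T] `*` D)).
  apply: filterI => //; apply: open_nbhs_nbhs; split; first exact: slab_open.
  by split.
pose U := (N `&` ([set: T] `*` D))°.
have oU : open U by exact: open_interior.
have UD : U `<=` [set: T] `*` D by move=> y /interior_subset[].
have oI := box_chart_open oU UD.
apply: filterS (open_nbhs_nbhs (conj oI _)); last by exists (t, z).
by move=> x [y /interior_subset[Ny [_ Dy]] <-]; exists y.
Qed.

Lemma box_chart_eq_act x g : D x.2 -> box_chart o (box_act o g x) = box_chart o x.
Proof.
move=> Dx; apply/esym/box_chart_fiber => //; first exact: box_act_stable.
by exists g.
Qed.

End Boxes.

(** * Unique continuation along leaves *)

Section Continuation.
Variable R : realType.
Local Notation C := (Cplx R).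
Variable A : affine_orbifold_lamination R.
Notation T i := (box_trans (lam_box A i)).
Notation D i := (box_dom (lam_box A i)).
Notation ch i := (box_chart (lam_box A i)).
Implicit Types (i j k : lam_index A) (phi psi : C -> A) (c u z w : C).

Definition has_germ phi c : Prop :=
  exists i (t : T i) z a, affine_germ phi c t z a.

Lemma near_and (c : C) (P Q : set C) :
  (\forall u \near c, P u) -> (\forall u \near c, Q u) ->
  \forall u \near c, P u /\ Q u.
Proof. exact: filterI. Qed.

Lemma germ_ball phi c i (t : T i) z a : affine_germ phi c t z a ->
  exists2 e : R, 0 < e & forall u, cmod (u - c) < e ->
    D i (z + a * (u - c)) /\ phi u = ch i (t, z + a * (u - c)).
Proof.
move=> [Dz a0 /nearCP[e e0 He]].
have [r r0 rD] := box_dom_near Dz.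
have ca0 : 0 < cmod a by rewrite cmod_gt0.
exists (Num.min e (r / cmod a)); first by rewrite lt_min e0 divr_gt0.
move=> u; rewrite lt_min => /andP[ue ur]; split.
  apply: rD; rewrite addrAC subrr add0r cmodM mulrC.
  by rewrite -ltr_pdivlMr.
by rewrite -(He (u - c)) ?subr0 // addrC subrK.
Qed.

Lemma germ_center phi c i (t : T i) z a : affine_germ phi c t z a ->
  phi c = ch i (t, z).
Proof.
by move=> [_ _ /nbhs_singleton]; rewrite mulr0 !addr0.
Qed.

Lemma box_germ i (t : T i) z a c u : a != 0 -> D i (z + a * (u - c)) ->
  affine_germ (fun v => ch i (t, z + a * (v - c))) u t (z + a * (u - c)) a.
Proof.
move=> a0 Du; split=> //; apply: filterE => v.
by congr (ch i (t, _)); ring.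
Qed.

Lemma germ_shift phi c i (t : T i) z a u : affine_germ phi c t z a ->
  D i (z + a * (u - c)) ->
  (\forall v \near u, phi v = ch i (t, z + a * (v - c))) ->
  affine_germ phi u t (z + a * (u - c)) a.
Proof.
move=> [_ a0 _] Du /nearCP[e e0 He]; split=> //; apply/nearCP; exists e => // v.
rewrite subr0 => ve; rewrite He; last by rewrite addrAC subrr add0r.
by congr (ch i (t, _)); ring.
Qed.

Lemma has_germ_cts phi c : has_germ phi c -> {for c, continuous phi}.
Proof.
move=> [i [t [z [a ga]]]]; have [e e0 He] := germ_ball ga.
have [Dz a0 _] := ga.
have phic := germ_center ga.
move=> U; rewrite phic => /(box_chart_cts Dz) /nbhs_slab[S [r [tS r0 SU]]].
apply/nearCP.
have a1 : 0 < cmod a by rewrite cmod_gt0.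
exists (Num.min e (r / cmod a)); first by rewrite lt_min e0 divr_gt0.
move=> u; rewrite lt_min => /andP[ue ur]; have [_ E] := He u ue.
rewrite /= E; apply: SU; first exact: nbhs_singleton.
by rewrite addrAC subrr add0r cmodM mulrC -ltr_pdivlMr.
Qed.

Lemma lam_separated (x y : A) : x <> y -> exists U V,
  [/\ nbhs x U, nbhs y V & forall x', U x' -> V x' -> False].
Proof.
move=> /eqP xy; have := @lam_hausdorff _ A; rewrite open_hausdorff.
move=> /(_ _ _ xy)[[U V] /= [/set_mem Ux /set_mem Vy] [oU oV /eqP UV]].
exists U, V; split; [exact: open_nbhs_nbhs|exact: open_nbhs_nbhs|].
by move=> z Uz Vz; have : (U `&` V) z by []; rewrite UV.
Qed.

(** Each [u] near [a] gives an element of the box group that matches the two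
    parametrizations at [u].  As the group is finite, one element serves two distinct
    values of [u]; being affine on the local leaf, it matches them everywhere. *)
Lemma box_affine_agree j (s : T j) (w al ga c a : C) (P : set C) :
  (forall u, P u -> D j (w + al * (u - c)) /\ D j (w + ga * (u - c))) ->
  (\forall u \near a, P u) ->
  (\forall u \near a, ch j (s, w + al * (u - c)) = ch j (s, w + ga * (u - c))) ->
  forall u, P u -> ch j (s, w + al * (u - c)) = ch j (s, w + ga * (u - c)).
Proof.
move=> PD nP ne.
have /nearCP[e e0 He] := near_and nP ne.
set G := box_group (lam_box A j).
pose kap : R := e / (#|G|.+1)%:R.
have kap0 : 0 < kap by rewrite divr_gt0.
pose pt (l : nat) : C := a + kap%:C * l%:R.
have ptE (l : nat) : (l <= #|G|)%N -> cmod (pt l - a) < e.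
  move=> lG; rewrite /pt addrAC subrr add0r cmodM cmodR cmod_nat gtr0_norm //.
  rewrite /kap -mulrA gtr_pMr // mulrC ltr_pdivrMr ?ltr0n // mul1r ltr_nat ltnS //.
pose Q l (g : G) := (s, w + ga * (pt l - c)) =
                    box_act (lam_box A j) g (s, w + al * (pt l - c)).
have [l [m [g [/andP[lm mG] Ql Qm]]]] : exists l m g,
    [/\ (l < m <= #|G|)%N, Q l g & Q m g].
  apply: finite_repeat => l lG.
  have [Pl El] := He _ (ptE l lG); have [D1 D2] := PD _ Pl.
  by have /box_chart_fiber[//|//|g gE] := El; exists g.
have [s' [a' [b' [a'0 aff]]]] := @box_act_affine _ _ (lam_box A j) g s.
have [Pl _] := He _ (ptE l (leq_trans (ltnW lm) mG)).
have [Pm _] := He _ (ptE m mG).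
have [D1l D2l] := PD _ Pl; have [D1m D2m] := PD _ Pm.
move: Ql Qm; rewrite /Q !aff // => -[ss' El] [_ Em].
have ptlm : pt m - pt l != 0.
  rewrite /pt opprD addrACA subrr add0r -mulrBr mulf_neq0 //.
    by rewrite fmorph_eq0 gt_eqF.
  by rewrite -natrB ?pnatr_eq0 ?subn_eq0 -?ltnNge // ltnW.
have gaE : ga = a' * al.
  apply: (mulIf ptlm).
  transitivity ((w + ga * (pt m - c)) - (w + ga * (pt l - c))); first by ring.
  by rewrite El Em; ring.
have wE : a' * w + b' = w.
  have -> : a' * w + b' = a' * (w + al * (pt l - c)) + b' - a' * al * (pt l - c) by ring.
  by rewrite -El gaE addrK.
move=> u Pu; have [D1 D2] := PD u Pu.
rewrite -(@box_chart_eq_act _ _ _ (s, w + al * (u - c)) g) // aff // -ss'.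
congr (ch j (s, _)).
have -> : a' * (w + al * (u - c)) + b' = (a' * w + b') + a' * al * (u - c) by ring.
by rewrite wE gaE.
Qed.

(** If the values at [c] differ, the curves are disjoint near [c]; if they agree, both
    curves can be read in one box. *)
Lemma unique_continuation_local psi1 psi2 c : has_germ psi1 c -> has_germ psi2 c ->
  exists2 e : R, 0 < e & forall a b, cmod (a - c) < e -> cmod (b - c) < e ->
    (\forall u \near a, psi1 u = psi2 u) -> \forall u \near b, psi1 u = psi2 u.
Proof.
move=> g1 g2; have [E|NE] := pselect (psi1 c = psi2 c); last first.
  have [U [V [xU yV UV]]] := lam_separated NE.
  have /nearCP[e e0 He] := near_and (has_germ_cts g1 xU) (has_germ_cts g2 yV).
  exists e; first exact: e0.
  move=> a b ae _ /nbhs_singleton E; have [Ua Va] := He a ae.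
  by case: (UV _ Ua); rewrite E.
have [j [s [w [al ga]]]] := g1; have [k [s2 [w2 [al2 ga2]]]] := g2.
have [e1 e10 He1] := germ_ball ga; have [e2 e20 He2] := germ_ball ga2.
have [Dw al0 _] := ga; have [Dw2 al20 _] := ga2.
have Ej := germ_center ga; have Ek := germ_center ga2.
have Ejk : ch k (s2, w2) = ch j (s, w) by rewrite -Ej -Ek E.
have [be [be0 /nearCP[e3 e30 He3]]] := lam_compat Dw2 Dw Ejk.
pose gam := be * al2.
have [r r0 rD] := box_dom_near Dw.
have cgam : 0 < cmod gam by rewrite cmod_gt0 mulf_neq0.
have cal2 : 0 < cmod al2 by rewrite cmod_gt0.
pose e := Num.min (Num.min e1 e2) (Num.min (e3 / cmod al2) (r / cmod gam)).
have e0 : 0 < e by rewrite !lt_min e10 e20 !divr_gt0.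
have Hball u : cmod (u - c) < e ->
    [/\ D j (w + al * (u - c)), D j (w + gam * (u - c)),
        psi1 u = ch j (s, w + al * (u - c)) & psi2 u = ch j (s, w + gam * (u - c))].
  rewrite !lt_min => /andP[/andP[u1 u2] /andP[u3 u4]].
  have [D1 E1] := He1 u u1; have [D2 E2] := He2 u u2.
  split=> //.
    by apply: rD; rewrite addrAC subrr add0r cmodM mulrC -ltr_pdivlMr.
  rewrite E2 He3; first by rewrite /gam mulrA.
  by rewrite subr0 cmodM mulrC -ltr_pdivlMr.
exists e; first exact: e0.
move=> a b ae be' nab.
have near_ball (v : C) : cmod (v - c) < e -> \forall u \near v, cmod (u - c) < e.
  move=> ve; apply/nearCP; exists (e - cmod (v - c)); first by rewrite subr_gt0.
  move=> u uv; rewrite -(subrK v u) -addrA; apply: le_lt_trans (cmodD _ _) _; lra.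
apply: filterS (near_ball b be') => u ue.
have [_ _ -> ->] := Hball u ue.
apply: (@box_affine_agree j s w al gam c a [set u | cmod (u - c) < e]) => //.
- by move=> v /Hball[].
- exact: near_ball.
apply: filterS2 nab (near_ball a ae) => v E12 /Hball[_ _ E1 E2].
by rewrite -E1 -E2.
Qed.

Lemma unique_continuation psi1 psi2 c (rho : R) : 0 < rho ->
  (forall u, cmod (u - c) < rho -> has_germ psi1 u) ->
  (forall u, cmod (u - c) < rho -> has_germ psi2 u) ->
  (\forall u \near c, psi1 u = psi2 u) ->
  forall u, cmod (u - c) < rho -> \forall v \near u, psi1 v = psi2 v.
Proof.
move=> rho0 g1 g2 nc u ur.
pose pt (x : R) : C := c + x%:C * (u - c).
have pt_in x : 0 <= x <= 1 -> cmod (pt x - c) < rho.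
  move=> /andP[x0 x1]; rewrite /pt addrAC subrr add0r cmodM cmodR ger0_norm //.
  by apply: le_lt_trans ur; rewrite ler_piMl // cmod_ge0.
have -> : u = pt 1 by rewrite /pt mul1r addrC subrK.
apply: (@unit_interval_chain R (fun x => \forall v \near pt x, psi1 v = psi2 v)).
  by rewrite /pt mul0r addr0.
move=> x x01; have [e e0 He] := unique_continuation_local (g1 _ (pt_in x x01)) (g2 _ (pt_in x x01)).
have d0 : 0 < cmod (u - c) + 1 by rewrite ltr_wpDl ?cmod_ge0.
exists (e / (cmod (u - c) + 1)); first by rewrite divr_gt0.
have ptd s : `|s - x| < e / (cmod (u - c) + 1) -> cmod (pt s - pt x) < e.
  rewrite ltr_pdivlMr // => H; have -> : pt s - pt x = (s - x)%:C * (u - c).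
    by rewrite /pt rmorphB /=; ring.
  rewrite cmodM cmodR; apply: le_lt_trans H.
  by rewrite ler_wpM2l // lerDl.
by move=> s t _ _ /ptd ss /ptd tt; exact: He.
Qed.

End Continuation.

(** * Continuity of box transitions *)

Section Transition.
Variable R : realType.
Local Notation C := (Cplx R).
Variable A : affine_orbifold_lamination R.
Notation T i := (box_trans (lam_box A i)).
Notation D i := (box_dom (lam_box A i)).
Notation ch i := (box_chart (lam_box A i)).
Implicit Types (i j k : lam_index A) (phi psi : C -> A) (c u z w : C).

Lemma chart_transfer j k (x : T j * C) (y : T k * C) (N : set (T k * C)) :
  D j x.2 -> D k y.2 -> ch j x = ch k y -> nbhs y N ->
  nbhs x [set x' | D j x'.2 /\ exists y', [/\ N y', D k y'.2 & ch k y' = ch j x']].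
Proof.
case: x y => [s w] [s2 w2] /= Dw Dw2 E nN.
have H := box_chart_image_nbhs Dw2 nN; rewrite -E in H.
have Dn : nbhs (s, w) [set x : T j * C | D j x.2].
  have : nbhs (s, w) ([set: T j] `*` D j).
    by apply: open_nbhs_nbhs; split; [exact: slab_open|split].
  by apply: filterS => x [].
by apply: filterS2 Dn (box_chart_cts Dw H) => x Dx Hx; split.
Qed.

(** A point [((s, w), al)] stands for the germ at 0 of the curve
    [u |-> chart (s, w + al u)]. *)
Definition germ_eq j k (x : T j * C * C) (y : T k * C * C) : Prop :=
  \forall u \near (0 : C),
    ch j (x.1.1, x.1.2 + x.2 * u) = ch k (y.1.1, y.1.2 + y.2 * u).

(** Pointwise, [lam_compat] provides a factor [be] for the box [k], but neither
    continuity nor a bound, and the base point is only determined up to the box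
    group.  A bound on [be] comes first: the disc of centre [w0] and radius
    [|be| e0] lies in the union of the small sets around the orbit of [(s2, w2)], so a
    large [be] would produce two points far apart in one of them.  Then the curve
    is sampled at [n + 1] points; two samples are matched with the limit curve by
    the same group element [g], and two points determine an affine map up to
    the error made at them.  Hence the germ transformed by [g] is close to [y]. *)
Lemma box_transition j k (x : T j * C * C) (y : T k * C * C) (N : set (T k * C * C)) :
  D j x.1.2 -> D k y.1.2 -> x.2 != 0 -> y.2 != 0 -> germ_eq x y -> nbhs y N ->
  \forall x' \near x, D j x'.1.2 /\ exists y',
     [/\ N y', D k y'.1.2, y'.2 != 0 & germ_eq x' y'].
Proof.
case: x y => [[s w] al] [[s2 w2] al2] /= Dw Dw2 al0 al20 E.
move=> /(@nbhs_slab R (T k * C)%type (s2, w2) al2 N)[N1 [rb [nN1 rb0 HN]]].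
have /nbhs_slab[S [rw [nS rw0 HS]]] := nN1.
set G := box_group (lam_box A k); set n := #|G|.
have [r2 r20 Hr2] := box_dom_near Dw2.
pose eta2 := r2 / 2; have eta20 : 0 < eta2 by rewrite divr_gt0.
have n1 : 0 < n.+1%:R :> R by rewrite ltr0n.
pose eta1 := eta2 / (2 * n.+1%:R); have eta10 : 0 < eta1 by rewrite divr_gt0 // mulr_gt0.
pose zg (g : G) := (box_act (lam_box A k) g (s2, w2)).2.
pose O2 := [set y : T k * C | cmod (y.2 - w2) < eta2 /\
   forall g, cmod ((box_act (lam_box A k) g y).2 - zg g) < eta1].
have nO2 : nbhs (s2, w2) O2.
  apply: filterI.
    by apply/nbhs_slab; exists setT, eta2; split=> //; exact: filterT.
  apply: (@filter_forall _ G
    (fun g (y : T k * C) => cmod ((box_act (lam_box A k) g y).2 - zg g) < eta1)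
    _ (nbhs_filter _)) => g.
  have H : nbhs (box_act (lam_box A k) g (s2, w2))
      [set y : T k * C | cmod (y.2 - zg g) < eta1].
    rewrite /zg; case: (box_act _ g _) => [sg z].
    by apply/nbhs_slab; exists setT, eta1; split=> //; exact: filterT.
  exact: (box_act_cts Dw2 H).
have Ecenter : ch j (s, w) = ch k (s2, w2).
  by have := nbhs_singleton E; rewrite /= !mulr0 !addr0.
have P0 := @chart_transfer j k (s, w) (s2, w2) O2 Dw Dw2 Ecenter nO2.
have P0' : nbhs (s, w + al * 0) [set x' : T j * C | D j x'.2 /\
    exists y', [/\ O2 y', D k y'.2 & ch k y' = ch j x']].
  by rewrite mulr0 addr0.
have [M0 [e0 [nM0 e00 HM0]]] := nbhs_shift P0'.
have /nearCP[eu eu0 Heu] := E.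
have cal2 : 0 < cmod al2 by rewrite cmod_gt0.
pose mu := Num.min e0 (Num.min eu (r2 / cmod al2)).
have mu0 : 0 < mu by rewrite !lt_min e00 eu0 divr_gt0.
pose kap := mu / n.+1%:R; have kap0 : 0 < kap by rewrite divr_gt0.
pose pt (l : nat) : C := kap%:C * l%:R.
have ptmu l : (l <= n)%N -> cmod (pt l) < mu.
  move=> ln; rewrite /pt cmodM cmodR cmod_nat gtr0_norm // /kap -mulrA gtr_pMr //.
  by rewrite mulrC ltr_pdivrMr // mul1r ltr_nat ltnS.
pose e3 := Num.min rw rb; have e30 : 0 < e3 by rewrite lt_min rw0.
pose e' := Num.min (e3 * kap / 4) (e3 / (4 * n.+1%:R)).
have e'0 : 0 < e' by rewrite lt_min !divr_gt0 ?mulr_gt0.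
have nal : \forall x' \near (s, w, al), x'.2 != 0.
  apply/nbhs_slab; exists setT, (cmod al); split; [exact: filterT|by rewrite cmod_gt0|].
  move=> _ al' _ /= H; apply: contraTneq H => ->.
  by rewrite sub0r cmodN ltxx.
have nM0' : \forall x' \near (s, w, al), M0 x'.1 /\ cmod (x'.2 - al) < e0.
  by apply/nbhs_slab; exists M0, e0; split.
pose Ol (l : nat) := [set y : T k * C | S y.1 /\ cmod (y.2 - (w2 + al2 * pt l)) < e'].
have nsample : \forall x' \near (s, w, al), forall l : 'I_n.+1,
    exists y', [/\ Ol l y', D k y'.2 & ch k y' = ch j (x'.1.1, x'.1.2 + x'.2 * pt l)].
  apply: (@filter_forall _ 'I_n.+1 (fun l (x' : T j * C * C) =>
    exists y', [/\ Ol l y', D k y'.2 & ch k y' = ch j (x'.1.1, x'.1.2 + x'.2 * pt l)])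
    _ (nbhs_filter _)) => l.
  have lmu : cmod (pt l) < mu by apply: ptmu; rewrite -ltnS.
  move: (lmu); rewrite !lt_min => /and3P[l1 l2 l3].
  have El : ch j (s, w + al * pt l) = ch k (s2, w2 + al2 * pt l).
    by apply: (Heu (pt l)); rewrite subr0.
  have Dl2 : D k (w2 + al2 * pt l).
    by apply: Hr2; rewrite addrAC subrr add0r cmodM mulrC -ltr_pdivlMr.
  have Dl : D j (w + al * pt l).
    have [] := HM0 s w al (pt l) (nbhs_singleton nM0); rewrite ?subrr ?cmod0 ?subr0 //.
  have nOl : nbhs (s2, w2 + al2 * pt l) (Ol l).
    by apply/nbhs_slab; exists S, e'; split.
  have Pl := @chart_transfer j k (s, _) (s2, _) (Ol l) Dl Dl2 El nOl.
  have [M [e [nM ee0 HM]]] := nbhs_shift Pl.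
  apply/nbhs_slab; exists M, e; split=> // -[s' w'] al' Ms' /= ale.
  have [|_ H] := HM s' w' al' (pt l) Ms' ale; first by rewrite subrr cmod0.
  exact: H.
apply: filterS (filterI nal (filterI nM0' nsample)) => -[[s' w'] al'].
move=> /= [al'0 [[Ms' ale] Hl]].
have Hu u : cmod u < e0 -> D j (w' + al' * u) /\
    exists y', [/\ O2 y', D k y'.2 & ch k y' = ch j (s', w' + al' * u)].
  by move=> ue; apply: HM0 => //; rewrite subr0.
have [Dw' [[s0 w0] [[/= w0w2 _] Dw0 E0]]] := Hu 0 ltac:(by rewrite cmod0).
rewrite mulr0 addr0 in Dw' E0.
split=> //.
have [be0 [be00 nE]] := lam_compat Dw' Dw0 (esym E0).
pose be := be0 * al'.
have beN0 : be != 0 by rewrite mulf_neq0.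
have cbe : 0 < cmod be by rewrite cmod_gt0.
pose psi1 u := ch j (s', w' + al' * (u - 0)).
pose psi2 u := ch k (s0, w0 + be * (u - 0)).
have nE' : \forall u \near (0 : C), psi1 u = psi2 u.
  have /nearCP[e ee He] := nE.
  have cal' : 0 < cmod al' by rewrite cmod_gt0.
  apply/nearCP; exists (e / cmod al'); first by rewrite divr_gt0.
  move=> u; rewrite /psi1 /psi2 subr0 => ue.
  rewrite He; first by rewrite /be mulrA.
  by rewrite subr0 cmodM mulrC -ltr_pdivlMr.
have agree (rho : R) : 0 < rho -> rho <= e0 -> cmod be * rho <= eta2 ->
    forall u, cmod u < rho -> D k (w0 + be * u) /\
      ch j (s', w' + al' * u) = ch k (s0, w0 + be * u).
  move=> rho0 rhoe rhobe.
  have Dbe u : cmod u < rho -> D k (w0 + be * u).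
    move=> ur; apply: Hr2.
    have -> : w0 + be * u - w2 = (w0 - w2) + be * u by ring.
    apply: le_lt_trans (cmodD _ _) _; rewrite cmodM.
    have : cmod be * cmod u <= eta2.
      by apply: le_trans rhobe; rewrite ler_pM2l // ltW.
    rewrite /eta2 in w0w2 *; lra.
  move=> u ur; split; first exact: Dbe.
  have ur0 : cmod (u - 0) < rho by rewrite subr0.
  have := @unique_continuation R A psi1 psi2 0 rho rho0 _ _ nE' u ur0.
  move=> /(_ _ _)/nbhs_singleton; rewrite /psi1 /psi2 subr0; apply.
    move=> v; rewrite subr0 => vr; exists j, s', (w' + al' * (v - 0)), al'.
    apply: box_germ => //; rewrite subr0.
    by have [] := Hu v (lt_le_trans vr rhoe).
  move=> v; rewrite subr0 => vr; exists k, s0, (w0 + be * (v - 0)), be.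
  by apply: box_germ => //; rewrite subr0; exact: Dbe.
have be_small : cmod be * e0 <= eta2.
  rewrite leNgt; apply/negP => big.
  pose rho := eta2 / cmod be.
  have rho0 : 0 < rho by rewrite divr_gt0.
  have rhoe : rho <= e0 by rewrite ltW // ltr_pdivrMr // mulrC.
  have rhob : cmod be * rho <= eta2 by rewrite mulrC divfK // gt_eqF.
  pose pu (l : nat) : C := (eta2 / n.+1%:R)%:C * l%:R / be.
  have pur l : (l <= n)%N -> cmod (pu l) < rho.
    move=> ln; rewrite /pu !cmodM cmodV cmodR cmod_nat ger0_norm ?divr_ge0 ?ltW //.
    rewrite /rho ltr_pM2r ?invr_gt0 // -mulrA gtr_pMr //.
    by rewrite mulrC ltr_pdivrMr // mul1r ltr_nat ltnS.
  pose Q l (g : G) := cmod (w0 + be * pu l - zg g) < eta1.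
  have [l [m [g [/andP[lm mn] Ql Qm]]]] : exists l m g,
      [/\ (l < m <= n)%N, Q l g & Q m g].
    apply: finite_repeat => l ln.
    have [Db Eb] := agree rho rho0 rhoe rhob _ (pur l ln).
    have [_ [yl [[_ Hg] Dyl Eyl]]] := Hu (pu l) (lt_le_trans (pur l ln) rhoe).
    have : ch k yl = ch k (s0, w0 + be * pu l) by rewrite Eyl Eb.
    move=> /box_chart_fiber[//|//|g gE]; exists g.
    by have := Hg g; rewrite -gE.
  have : cmod (be * pu m - be * pu l) < 2 * eta1.
    have -> : be * pu m - be * pu l = (w0 + be * pu m - zg g) - (w0 + be * pu l - zg g) by ring.
    by apply: le_lt_trans (cmodB _ _) _; rewrite /Q in Ql Qm; lra.
  have -> : be * pu m - be * pu l = (eta2 / n.+1%:R)%:C * (m - l)%:R.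
    rewrite natrB 1?ltnW // /pu; move: ((eta2 / _)%:C : C) => x.
    by field; exact: beN0.
  rewrite cmodM cmodR cmod_nat ger0_norm ?divr_ge0 ?ltW //.
  have -> : 2 * eta1 = eta2 / n.+1%:R * 1 by rewrite /eta1; field; rewrite gt_eqF.
  rewrite ltr_pM2l ?divr_gt0 // -[1]/(1%:R) ltr_nat ltnS leqNgt subn_gt0 lm //.
have {}agree := agree e0 e00 (lexx _) be_small.
pose Q l (g : G) := S (box_act (lam_box A k) g (s0, w0 + be * pt l)).1 /\
  cmod ((box_act (lam_box A k) g (s0, w0 + be * pt l)).2 - (w2 + al2 * pt l)) < e'.
have pte l : (l <= n)%N -> cmod (pt l) < e0.
  by move=> /ptmu/lt_le_trans; apply; rewrite ge_min lexx.
have [l [m [g [/andP[lm mn] Ql Qm]]]] : exists l m g,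
    [/\ (l < m <= n)%N, Q l g & Q m g].
  apply: finite_repeat => l ln.
  have [Db Eb] := agree _ (pte l ln).
  have [yl [Oyl Dyl Eyl]] := Hl (Ordinal (ln : (l < n.+1)%N)).
  have : ch k (s0, w0 + be * pt l) = ch k yl by rewrite Eyl Eb.
  by move=> /box_chart_fiber[//|//|g gE]; exists g; rewrite /Q -gE.
have [sg [a [b [a0 aff]]]] := @box_act_affine _ _ (lam_box A k) g s0.
have [Dl _] := agree _ (pte l (leq_trans (ltnW lm) mn)).
have [Dm _] := agree _ (pte m mn).
move: Ql Qm; rewrite /Q !aff //= => -[Ssg Hl'] [_ Hm'].
have E' z : a * (w0 + be * z) + b = (a * w0 + b) + a * be * z by ring.
rewrite !E' in Hl' Hm'.
set om := a * w0 + b in Hl' Hm'; set bb := a * be in Hl' Hm'.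
have ptlm : cmod (pt m - pt l) = kap * (m - l)%:R.
  by rewrite /pt -mulrBr -natrB 1?ltnW // cmodM cmodR cmod_nat gtr0_norm.
have ml1 : 1 <= (m - l)%:R :> R by rewrite -[1]/(1%:R) ler_nat subn_gt0.
have bbd : cmod (bb - al2) * (kap * (m - l)%:R) < 2 * e'.
  rewrite -ptlm -cmodM.
  have -> : (bb - al2) * (pt m - pt l) =
    (om + bb * pt m - (w2 + al2 * pt m)) - (om + bb * pt l - (w2 + al2 * pt l)) by ring.
  by apply: le_lt_trans (cmodB _ _) _; lra.
have bbk : cmod (bb - al2) * kap < 2 * e'.
  apply: le_lt_trans bbd; apply: ler_wpM2l; first exact: cmod_ge0.
  by rewrite ler_peMr // ltW.
have e'1 : e' <= e3 * kap / 4 by rewrite ge_min lexx.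
have e'2 : e' * (4 * n.+1%:R) <= e3.
  by rewrite -ler_pdivlMr ?mulr_gt0 // ge_min lexx orbT.
have bb1 : cmod (bb - al2) < rb.
  have : e3 <= rb by rewrite ge_min lexx orbT.
  apply: lt_le_trans; rewrite -(ltr_pM2r kap0); apply: lt_trans bbk _.
  by have := mulr_gt0 e30 kap0; lra.
have om1 : cmod (om - w2) < rw.
  have : e3 <= rw by rewrite ge_min lexx.
  apply: lt_le_trans.
  have -> : om - w2 = (om + bb * pt l - (w2 + al2 * pt l)) - (bb - al2) * pt l by ring.
  apply: le_lt_trans (cmodB _ _) _; rewrite cmodM.
  have : cmod (bb - al2) * cmod (pt l) <= 2 * e' * n%:R.
    rewrite /pt cmodM cmodR cmod_nat gtr0_norm // mulrA.
    apply: ler_pM => //; last by rewrite ler_nat (leq_trans (ltnW lm)).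
      by apply: mulr_ge0; [exact: cmod_ge0|exact: ltW].
    exact: ltW.
  have n0 : 0 <= n%:R :> R by rewrite ler0n.
  rewrite -natr1 in e'2; have := mulr_ge0 (ltW e'0) n0; lra.
exists (sg, om, bb); split => /=.
- by apply: HN => //; exact: HS.
- by have := box_act_stable g (Dw0 : box_dom (lam_box A k) (s0, w0).2); rewrite aff.
- by rewrite mulf_neq0.
apply/nearCP; exists e0 => // u; rewrite subr0 => ue.
have [Du ->] := agree u ue.
rewrite -(@box_chart_eq_act _ _ _ (s0, w0 + be * u) g) // aff //.
by rewrite E'.
Qed.

End Transition.

(** * Propagation of germs *)

Section Propagation.
Variable R : realType.
Local Notation C := (Cplx R).
Variable A : affine_orbifold_lamination R.
Notation T i := (box_trans (lam_box A i)).
Notation D i := (box_dom (lam_box A i)).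
Notation ch i := (box_chart (lam_box A i)).
Implicit Types (i j k : lam_index A) (phi psi : C -> A) (c u z w : C).

Definition leaf_curve phi : Prop := forall c, has_germ phi c.

Definition germ_at phi c i (x : T i * C * C) : Prop :=
  affine_germ phi c x.1.1 x.1.2 x.2.

Lemma germ_at_change phi c i j (x : T i * C * C) (y : T j * C * C) :
  germ_at phi c x -> germ_eq x y -> D j y.1.2 -> y.2 != 0 -> germ_at phi c y.
Proof.
move=> [Dx x0 nx] xy Dy y0; split=> //.
by apply: filterS2 nx xy => u ->.
Qed.

Lemma germ_at_eq phi c i j (x : T i * C * C) (y : T j * C * C) :
  germ_at phi c x -> germ_at phi c y -> germ_eq x y.
Proof.
move=> [_ _ nx] [_ _ ny].
by apply: filterS2 nx ny => u -> ->.
Qed.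

Lemma germ_extend psi c i (x : T i * C * C) (rho : R) : 0 < rho ->
  leaf_curve psi -> germ_at psi c x ->
  (forall u, cmod (u - c) < rho -> D i (x.1.2 + x.2 * (u - c))) ->
  forall u, cmod (u - c) < rho ->
    \forall v \near u, psi v = ch i (x.1.1, x.1.2 + x.2 * (v - c)).
Proof.
move=> rho0 cpsi gx Dx u ur; have [_ x0 _] := gx.
apply: (@unique_continuation R A psi (fun v => ch i (x.1.1, x.1.2 + x.2 * (v - c)))
  c rho) => //.
  by move=> v vr; exists i, x.1.1, (x.1.2 + x.2 * (v - c)), x.2; apply: box_germ => //; exact: Dx.
have [e e0 He] := germ_ball gx.
by apply/nearCP; exists e => // v /He[].
Qed.

Variables (phi : C -> A) (i0 : lam_index A) (x0 : T i0 * C * C).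
Hypotheses (cphi : leaf_curve phi) (gphi : germ_at phi 0 x0).

(** Charts [psi] whose germ at 0 is close to that of [phi] have a germ at [c] close to
    that of [phi], in the coordinates of every box. *)
Definition germ_stable c : Prop := forall j (x : T j * C * C) N,
  germ_at phi c x -> nbhs x N ->
  \forall y \near x0, forall psi, leaf_curve psi -> germ_at psi 0 y ->
    exists2 x', N x' & germ_at psi c x'.

Lemma germ_stable0 : germ_stable 0.
Proof.
move=> j x N gx nN; have [D0 a0 _] := gphi; have [Dx ax _] := gx.
have := box_transition D0 Dx a0 ax (germ_at_eq gphi gx) nN.
apply: filterS => y [_ [x' [Nx' Dx' x'0 yx']]] psi _ gy.
by exists x' => //; exact: germ_at_change gy yx' Dx' x'0.
Qed.

(** The box of [c] describes [phi] on a disc, and by unique continuation also the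
    nearby [psi], whose germs thus move together from [a] to [b]; other boxes at [b]
    are reached through a box transition. *)
Lemma germ_stable_local c : exists2 e : R, 0 < e & forall a b,
  cmod (a - c) < e -> cmod (b - c) < e -> germ_stable a -> germ_stable b.
Proof.
have [j [s [w [al gc]]]] := cphi c.
have [Dw al0 _] := gc; have [e1 e10 He1] := germ_ball gc.
have [r r0 rD] := box_dom_near Dw.
have al1 : 0 < cmod al + 1 by rewrite ltr_wpDl ?cmod_ge0.
pose e := Num.min e1 (r / (8 * (cmod al + 1))).
have e0 : 0 < e by rewrite lt_min e10 divr_gt0 // mulr_gt0.
have er : e * (cmod al + 1) <= r / 8.
  have : e <= r / (8 * (cmod al + 1)) by rewrite ge_min lexx orbT.
  rewrite ler_pdivlMr ?mulr_gt0 //; lra.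
have ball_near a : cmod (a - c) < e ->
    germ_at phi a ((s, w + al * (a - c)), al).
  move=> ae; have ae1 : cmod (a - c) < e1.
    by apply: lt_le_trans ae _; rewrite ge_min lexx.
  have [Da _] := He1 a ae1.
  apply: (@germ_shift _ A phi c j s w al a gc Da).
  apply/nearCP; exists (e1 - cmod (a - c)); first by rewrite subr_gt0.
  move=> u uv; have [] // := He1 u.
  by rewrite -(subrK a u) -addrA; apply: le_lt_trans (cmodD _ _) _; lra.
exists e => // a b ae be' Qa k x N gx nN.
have ga := ball_near a ae; have gb := ball_near b be'.
have [Db _ _] := gb; have [Dx ax _] := gx.
have nNb := box_transition Db Dx al0 ax (germ_at_eq gb gx) nN.
have /(@nbhs_slab R (T j * C)%type (s, w + al * (b - c)) al)[N1 [rb [nN1 rb0 HN]]] := nNb.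
have E1 : w + al * (b - c) = (w + al * (a - c)) + al * (b - a) by ring.
rewrite E1 in nN1.
have [M [e2 [nM e20 HM]]] := nbhs_shift nN1.
pose Na := [set y : T j * C * C | [/\ M y.1, cmod (y.2 - al) < Num.min 1 (Num.min e2 rb) &
   cmod (y.1.2 - (w + al * (a - c))) < r / 4]].
have nNa : nbhs (s, w + al * (a - c), al) Na.
  apply/(@nbhs_slab R (T j * C)%type).
  exists (M `&` [set y | cmod (y.2 - (w + al * (a - c))) < r / 4]),
     (Num.min 1 (Num.min e2 rb)); split.
  - apply: filterI => //; apply/nbhs_slab; exists setT, (r / 4); split => //.
      exact: filterT.
    by rewrite divr_gt0.
  - by rewrite !lt_min ltr01 e20.
  - by move=> y al' [My yr] al'al.
apply: filterS (Qa j _ Na ga nNa) => y Hy psi cpsi gy.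
have [[[s' w'] al'] [/= Ms' al'al w'w] gpa] := Hy psi cpsi gy.
move: al'al; rewrite !lt_min => /and3P[al'1 al'2 al'3].
have al'b : cmod al' <= cmod al + 1 by have := cmod_dist al' al; lra.
have e20' : 0 < 2 * e by rewrite mulr_gt0.
have dom u : cmod (u - a) < 2 * e -> D j (w' + al' * (u - a)).
  move=> ua; apply: rD.
  have -> : w' + al' * (u - a) - w =
     (w' - (w + al * (a - c))) + (al * (a - c) + al' * (u - a)) by ring.
  apply: le_lt_trans (cmodD _ _) _.
  apply: le_lt_trans (lerD (lexx _) (cmodD _ _)) _; rewrite !cmodM.
  have H1 : cmod al * cmod (a - c) <= (cmod al + 1) * e.
    by apply: ler_pM; rewrite ?cmod_ge0 ?lerDl //; exact: ltW.
  have H2 : cmod al' * cmod (u - a) <= (cmod al + 1) * (2 * e).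
    by apply: ler_pM; rewrite ?cmod_ge0 //; exact: ltW.
  lra.
have ba : cmod (b - a) < 2 * e.
  have -> : b - a = (b - c) - (a - c) by ring.
  by apply: le_lt_trans (cmodB _ _) _; lra.
have near_b := germ_extend e20' cpsi gpa dom ba.
have gpb : germ_at psi b ((s', w' + al' * (b - a)), al').
  exact: (@germ_shift _ A psi a j s' w' al' b gpa (dom b ba) near_b).
have Nb : N1 (s', w' + al' * (b - a)) by apply: HM => //; rewrite subrr cmod0.
have [_ [x' [Nx' Dx' x'0 yx']]] := HN _ al' Nb al'3.
by exists x' => //; exact: germ_at_change gpb yx' Dx' x'0.
Qed.

Lemma germ_stable_all c : germ_stable c.
Proof.
have -> : c = (1 : R)%:C * c by rewrite mul1r.
apply: (@unit_interval_chain R (fun x => germ_stable (x%:C * c))).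
  by rewrite mul0r; exact: germ_stable0.
move=> x _; have [e e0 He] := germ_stable_local (x%:C * c).
have d0 : 0 < cmod c + 1 by rewrite ltr_wpDl ?cmod_ge0.
exists (e / (cmod c + 1)); first by rewrite divr_gt0.
have ptd s : `|s - x| < e / (cmod c + 1) -> cmod (s%:C * c - x%:C * c) < e.
  rewrite ltr_pdivlMr // => H; rewrite -mulrBl -rmorphB cmodM cmodR.
  by apply: le_lt_trans H; rewrite ler_wpM2l // lerDl.
by move=> s t _ _ /ptd ss /ptd tt; exact: He.
Qed.

(** Continuity of evaluation, uniformly near [c] as required for compactness
    arguments. *)
Lemma value_stable c (U : set A) : nbhs (phi c) U -> exists2 e : R, 0 < e &
  \forall y \near x0, forall psi, leaf_curve psi -> germ_at psi 0 y ->
    forall u, cmod (u - c) < e -> U (psi u).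
Proof.
move=> nU; have [j [s [w [al gc]]]] := cphi c; have [Dw _ _] := gc.
have nP : nbhs (s, w + al * 0) ([set y : T j * C | U (ch j y)] `&` ([set: T j] `*` D j)).
  rewrite mulr0 addr0; apply: filterI.
    by apply: (box_chart_cts Dw); rewrite -(germ_center gc).
  by apply: open_nbhs_nbhs; split; [exact: slab_open|split].
have [M [e [nM e0 HM]]] := nbhs_shift nP.
exists e => //.
have nN : nbhs ((s, w), al) [set y : T j * C * C | M y.1 /\ cmod (y.2 - al) < e].
  by apply/(@nbhs_slab R (T j * C)%type); exists M, e; split.
have gc' : germ_at phi c ((s, w), al) by [].
apply: filterS (germ_stable_all gc' nN) => y Hy psi cpsi gy u ue.
have [[[s' w'] al'] [/= Ms' ale] gpc] := Hy psi cpsi gy.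
have dom v : cmod (v - c) < e -> D j (w' + al' * (v - c)).
  by move=> ve; have [|_ []//] := HM s' w' al' (v - c) Ms' ale; rewrite subr0.
have /nbhs_singleton -> := germ_extend e0 cpsi gpc dom ue.
by have [] // := HM s' w' al' (u - c) Ms' ale; rewrite subr0.
Qed.

End Propagation.

(** * Neighbourhoods in the hyperbolic lamination *)

Section Hyp3.
Variable R : realType.
Local Notation C := (Cplx R).
Variable A : affine_orbifold_lamination R.
Notation T i := (box_trans (lam_box A i)).
Notation D i := (box_dom (lam_box A i)).
Notation ch i := (box_chart (lam_box A i)).
Implicit Types (i j k : lam_index A) (phi psi : C -> A) (p q : hyp3 A).

Lemma hyp3_leaf_curve p phi : sval p phi -> leaf_curve phi.
Proof.
case: p => X /= [phi0 lphi0 ->] [la la1 <-].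
have la0 : la != 0 by rewrite -normr_eq0 la1 oner_eq0.
by have [] := leaf_chart_scale la0 lphi0.
Qed.

Lemma hyp3_rotate p phi (la : C) : sval p phi -> cmod la = 1 -> sval p (phi \o *%R la).
Proof.
case: p => X /= [phi0 _ ->] [mu mu1 <-] la1; exists (mu * la).
  by rewrite /= normrM mu1 normC_cmod la1 mulr1.
by apply/funext => u /=; rewrite mulrA.
Qed.

Lemma hyp3_rotation p phi psi : sval p phi -> sval p psi ->
  exists2 la : C, cmod la = 1 & psi = phi \o *%R la.
Proof.
case: p => X /= [phi0 _ ->] [mu mu1 <-] [nu nu1 <-].
have mu0 : mu != 0 by rewrite -normr_eq0 mu1 oner_eq0.
exists (mu^-1 * nu); last by apply/funext => u /=; rewrite mulrA mulVKf.
by apply: complexI; rewrite -normC_cmod normrM normfV mu1 nu1 invr1 mulr1.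
Qed.

Lemma hyp3_inhabited p : exists2 phi, leaf_chart phi & sval p phi.
Proof.
case: p => X /= [phi0 lphi0 ->]; exists phi0 => //; exists 1; first by rewrite /= normr1.
by apply/funext => u /=; rewrite mul1r.
Qed.

Lemma germ_rotate phi i (x : T i * C * C) (la : C) : la != 0 ->
  germ_at phi 0 x -> germ_at (phi \o *%R la) 0 (x.1, x.2 * la).
Proof.
move=> la0 [Dx x0 /nearCP[e e0 He]]; split=> //=; first by rewrite mulf_neq0.
have cla : 0 < cmod la by rewrite cmod_gt0.
apply/nearCP; exists (e / cmod la); first by rewrite divr_gt0.
move=> u; rewrite subr0 add0r ltr_pdivlMr // => ue.
have := He (la * u); rewrite subr0 add0r cmodM mulrC => -> //.
by rewrite mulrA.
Qed.

(** One box suffices to recognize a neighbourhood, although openness refers to all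
    boxes.  The coordinates of a point give its germ up to a rotation; rotating the
    chart so that its factor has the argument of [al] reduces the matter to a box
    transition. *)
Lemma hyp3_nbhs p phi i (x : T i * C * C) (V : set (hyp3 A)) :
  sval p phi -> germ_at phi 0 x ->
  (\forall y \near x, forall q psi, sval q psi -> germ_at psi 0 y -> V q) ->
  nbhs p V.
Proof.
move=> pphi gx HV.
pose V0 : set (hyp3 A) := [set q : hyp3 A | exists psi j (y : T j * C * C),
  [/\ sval q psi, germ_at psi 0 y &
  \forall y' \near y, forall q' psi', sval q' psi' -> germ_at psi' 0 y' -> V q']].
have VV0 : V0 `<=` V.
  by move=> q [psi [j [y [qpsi gy /nbhs_singleton H]]]]; exact: H qpsi gy.
suff oV0 : open V0.
  apply: (@filterS _ (nbhs p) _ V0 V VV0); apply: open_nbhs_nbhs; split => //.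
  by exists phi, i, x.
suff : hyp3_open V0 by [].
move=> k [t2 [z2 rho]] p' [phi1 p'phi1 [a1 [/= a1rho ga1]]] [psi [j [y [p'psi gy Hy]]]].
have [la la1 phi1E] := hyp3_rotation p'psi p'phi1.
have la0 : la != 0 by rewrite -cmod_gt0 la1.
have [D2 a10 _] := ga1.
have rhoE : cmod a1 = rho by apply: complexI; rewrite -a1rho.
have rho0 : 0 < rho by rewrite -rhoE cmod_gt0.
pose al := a1 * la^-1.
have alrho : cmod al = rho by rewrite cmodM cmodV la1 invr1 mulr1.
have al0 : al != 0 by rewrite -cmod_gt0 alrho.
have gX : germ_at psi 0 (t2, z2, al).
  have -> : psi = phi1 \o *%R la^-1.
    by rewrite phi1E; apply/funext => u /=; rewrite mulVKf.
  have lav : la^-1 != 0 by rewrite invr_eq0.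
  exact: (@germ_rotate phi1 k (t2, z2, a1) _ lav ga1).
clearbody al.
have [Dy y0 _] := gy.
have nHy : nbhs y [set y' | \forall y'' \near y', forall q' psi',
    sval q' psi' -> germ_at psi' 0 y'' -> V q'].
  exact: nbhs_interior.
have := @box_transition R A k j (t2, z2, al) y _ D2 Dy al0 y0 (germ_at_eq gX gy) nHy.
move=> /(@nbhs_slab R (T k * C)%type (t2, z2) al)[N1 [rb [nN1 rb0 HN]]].
have /nbhs_slab[S [rw [nS rw0 HS]]] := nN1.
exists (S, ([set z | cmod (z - z2) < rw] `*` [set s : R | `|s - rho| < rb])).
  split=> //=; exists ([set z | cmod (z - z2) < rw], [set s : R | `|s - rho| < rb]).
    by split; [exact: near_cmod|exact: near_dist].
  by [].
move=> [t' [z' rho']] /= [St' [z'r rho'r]] q [chi qchi [a' [/= a'rho ga']]].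
have [_ a'0 _] := ga'.
have rhoE' : cmod a' = rho' by apply: complexI; rewrite -a'rho.
have rho'0 : 0 < rho' by rewrite -rhoE' cmod_gt0.
pose mu := al * (rho' / rho)%:C / a'.
have mu1 : cmod mu = 1.
  by rewrite !cmodM cmodV cmodR alrho rhoE' gtr0_norm ?divr_gt0 //; field; rewrite !gt_eqF.
have mu0 : mu != 0 by rewrite -cmod_gt0 mu1.
have gchi : germ_at (chi \o *%R mu) 0 (t', z', al * (rho' / rho)%:C).
  have -> : al * (rho' / rho)%:C = a' * mu by rewrite /mu [a' * _]mulrC divfK.
  by apply: (@germ_rotate chi k (t', z', a') mu mu0).
have [] := HN (t', z') (al * (rho' / rho)%:C) (HS _ _ St' z'r).
  have -> : al * (rho' / rho)%:C - al = al * ((rho' - rho) / rho)%:C.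
    by rewrite mulrBl divff ?gt_eqF // rmorphB /= mulrBr mulr1.
  rewrite cmodM cmodR alrho normrM normfV (gtr0_norm rho0).
  by rewrite mulrC divfK // gt_eqF.
move=> _ [y' [Hy' Dy' y'0 Ey']].
exists (chi \o *%R mu), j, y'; split=> //; first exact: hyp3_rotate.
exact: germ_at_change gchi Ey' Dy' y'0.
Qed.

Lemma hyp3_value_nbhs p phi (c : C) (U : set A) : sval p phi -> nbhs (phi c) U ->
  exists2 e : R, 0 < e & nbhs p [set q | exists2 psi, sval q psi &
     forall u, cmod (u - c) < e -> U (psi u)].
Proof.
move=> pphi nU; have cphi := hyp3_leaf_curve pphi.
have [i [t [z [a ga]]]] := cphi 0.
have gx : germ_at phi 0 ((t, z), a) by [].
have [e e0 He] := value_stable cphi gx nU; exists e => //.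
apply: (hyp3_nbhs pphi gx); apply: filterS He => y Hy q psi qpsi gpsi.
by exists psi => // u; apply: Hy => //; exact: hyp3_leaf_curve qpsi.
Qed.

End Hyp3.

(** * The two actions *)

Section Dynamics.
Variable R : realType.
Local Notation C := (Cplx R).
Variables (f : sphere R -> sphere R) (E : affine_extension f).
Implicit Types (p q : hyp3 E) (phi psi : C -> E).

Lemma csquare_cmod_lt (z0 z : C) (d e : R) : csquare z0 d z -> d + d < e ->
  cmod (z - z0) < e.
Proof.
move=> /andP[H1 H2]; apply: le_lt_trans; apply: le_trans (cmod_le_ReIm _) _.
exact: lerD.
Qed.

(** Charts near a chart of [q] take values near [phi c] close to each [c]; compactness
    of the square makes the scale uniform. *)
Lemma hyp3_small_patches q (r : R) : exists2 delta : R, 0 < delta &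
  nbhs q [set q' : hyp3 E | exists2 psi, sval q' psi &
    small_patches (@ext_proj R f E \o psi) r delta].
Proof.
have [phi _ qphi] := hyp3_inhabited q.
have cphi := hyp3_leaf_curve qphi.
have [i [t [z [a ga]]]] := cphi 0.
pose x0 := ((t, z), a); have gx : germ_at phi 0 x0 by [].
pose pi_ := @ext_proj R f E.
pose P (yd : (box_trans (lam_box E i) * C * C) * R) (z0 : C) :=
  forall psi, leaf_curve psi -> germ_at psi 0 yd.1 ->
  (forall z, csquare z0 yd.2 z -> near_zero (pi_ (psi z))) \/
  (forall z, csquare z0 yd.2 z -> near_infinity (pi_ (psi z))).
have local c (Q : sphere R -> bool) : nbhs (pi_ (phi c)) [set x | Q x] ->
   \forall z0 \near c & yd \near filter_prod (nbhs x0) (0^'+ : set_system R),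
     forall psi, leaf_curve psi -> germ_at psi 0 yd.1 ->
       forall z, csquare z0 yd.2 z -> Q (pi_ (psi z)).
  move=> nQ; have nU : nbhs (phi c) (pi_ @^-1` [set x | Q x]).
    exact: (@ext_proj_continuous R f E (phi c) _ nQ).
  have [e e0 He] := value_stable cphi gx nU.
  pose Y := [set y : box_trans (lam_box E i) * C * C | forall psi, leaf_curve psi ->
    germ_at psi 0 y -> forall u, cmod (u - c) < e -> Q (pi_ (psi u))].
  have e4 : 0 < e / 4 by rewrite divr_gt0.
  exists ([set z0 | cmod (z0 - c) < e / 4], Y `*` [set d : R | d < e / 4]).
    split; first exact: near_cmod.
    exists (Y, [set d : R | d < e / 4]) => //; split => //=.
    by apply: nbhs_right_lt.
  move=> [z0 [y d]] /= [z0c [Yy de]] psi cpsi gpsi u uz0.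
  apply: (Yy psi cpsi gpsi).
  rewrite -(subrK z0 u) -addrA; apply: le_lt_trans (cmodD _ _) _.
  have : cmod (u - z0) < 3 / 4 * e by apply: csquare_cmod_lt uz0 _; lra.
  lra.
have cover : forall c : C, csquare 0 r c ->
   \forall z0 \near c & yd \near filter_prod (nbhs x0) (0^'+ : set_system R), P yd z0.
  move=> c _; have /orP[nz|ni] := near_zero_or_infinity (pi_ (phi c)).
    apply: filterS (local c _ (nbhs_near_zero nz)) => -[z0 yd] H psi cpsi gpsi.
    by left; exact: H.
  apply: filterS (local c _ (nbhs_near_infinity ni)) => -[z0 yd] H psi cpsi gpsi.
  by right; exact: H.
have /compact_near_coveringP ncov := @compact_csquare R r.
have [[Y Dl] /= [nY nDl] HYD] := ncov _ _ P _ cover.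
have [delta delta0 Ddelta] : exists2 delta : R, 0 < delta & Dl delta.
  have : \forall d \near (0 : R)^'+, Dl d /\ 0 < d.
    by apply: filterI => //; exact: nbhs_right_gt.
  move=> H; have [d [Dd d0]] := @filter_ex _ ((0 : R)^'+) _ _ H.
  by exists d.
exists delta => //; apply: (hyp3_nbhs qphi gx).
apply: filterS nY => y Yy q' psi q'psi gpsi; exists psi => // z0 z0r.
exact: (HYD (y, delta) (conj Yy Ddelta) z0 z0r psi (hyp3_leaf_curve q'psi) gpsi).
Qed.

Lemma leaf_proj_derivable phi : leaf_curve phi ->
  forall z, sphere_derivable (@ext_proj R f E \o phi) z.
Proof.
move=> cphi z; have [i [t [w [a ga]]]] := cphi z.
have [Dw a0 _] := ga; have [e e0 He] := germ_ball ga.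
pose h (v : C) := @ext_proj R f E (box_chart (lam_box E i) (t, v)).
have : sphere_derivable h w := @ext_leaf_analytic R f E i t w Dw.
move=> [ch dh].
have gE : \forall u \near z, (@ext_proj R f E \o phi) u = h (w + a * (u - z)).
  by apply/nearCP; exists e => // u /He[_ E']; rewrite /= E'.
have gz : (@ext_proj R f E \o phi) z = h w by rewrite /= (germ_center ga).
split.
  exact: (continuous_comp (has_germ_cts (cphi z)) (@ext_proj_continuous R f E (phi z))).
rewrite gz; move: dh; rewrite -/(h w).
have comp (k : sphere R -> C) : derivable (k \o h) w 1 ->
   derivable (k \o (@ext_proj R f E \o phi)) z 1.
  move=> dk; have : hol (fun u => k (h (w + a * (u - z)))) z.
    apply: (@hol_comp R (k \o h) (fun u => w + a * (u - z))).
      apply: (@holD R (fun=> w) (fun u => a * (u - z))); first exact: hol_cst.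
      apply: (@holM R (fun=> a) (fun u => u - z)); first exact: hol_cst.
      by apply: (@holB R id (fun=> z)); [exact: hol_id|exact: hol_cst].
    by rewrite subrr mulr0 addr0; constructor.
  move=> H; have [] : hol (k \o (@ext_proj R f E \o phi)) z; last by [].
  by apply: hol_near H; apply: filterS gE => u /= ->.
by case: (h w) => [y|]; exact: comp.
Qed.

Lemma ext_iter_semiconj n x : @ext_proj R f E (ext_iter (Posz n) x) = iter n f (@ext_proj R f E x).
Proof.
elim: n x => //= n IH x.
have := congr1 (fun h => h (iter n (@ext_map R f E) x)) (@ext_semiconj R f E).
by rewrite /= => <-; rewrite -IH.
Qed.

Lemma hyp3_nonconstant p phi : sval p phi ->
  exists z1, @ext_proj R f E (phi z1) <> @ext_proj R f E (phi 0).
Proof.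
case: p => X /= [phi0 lphi0 ->] [la la1 <-].
have la0 : la != 0 by rewrite -normr_eq0 la1 oner_eq0.
have [rng _ _] := leaf_chart_scale la0 lphi0.
have [y ly yx] := @ext_leaf_nonconstant R f E ((phi0 \o *%R la) 0).
by rewrite -rng in ly; case: ly => z1 _ z1y; exists z1; rewrite z1y.
Qed.

(** A relation between rotation classes gives an actual relation [f^n \o g = h]
    between projected charts; the remaining rotations preserve 0 and the circle
    through [z1]. *)
Lemma forward_wandering d (p q : hyp3 E) : (2 <= d)%N -> rational_map d f ->
  exists U V, [/\ nbhs p U, nbhs q V & exists n0, forall n p' q', (n0 <= n)%N ->
    U p' -> V q' -> induced_act E (Posz n) (sval p') = sval q' -> False].
Proof.
move=> d2 [P [Q [PQ PQd fE]]].
have [phi _ pphi] := hyp3_inhabited p.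
have [z1 z1N] := hyp3_nonconstant pphi.
have [k k0 [N0 [N1 [nN0 nN1 sep]]]] := sphere_separation (not_eq_sym z1N).
pose R1 := cmod z1 + 1.
have R10 : 0 < R1 by rewrite ltr_wpDl ?cmod_ge0.
have [r r0 Hr] := iterates_rigid PQ PQd d2 k0 R10.
have [delta delta0 nV] := hyp3_small_patches q r.
have [n0 Hn0] := Hr delta delta0.
have [e0 e00 nU0] := hyp3_value_nbhs pphi (@ext_proj_continuous R f E (phi 0) _ nN0).
have [e1 e10 nU1] := hyp3_value_nbhs pphi (@ext_proj_continuous R f E (phi z1) _ nN1).
eexists; eexists; split; [exact: filterI nU0 nU1|exact: nV|].
exists n0 => n p' q' nn [[phi0 p'phi0 H0] [phi1 p'phi1 H1]] [psi q'psi small] act.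
have : induced_act E n (sval p') psi by rewrite act.
move=> [phi2 p'phi2 psiE].
have [la la1 E0] := hyp3_rotation p'phi2 p'phi0.
have [mu mu1 E1] := hyp3_rotation p'phi2 p'phi1.
pose g := @ext_proj R f E \o phi2.
have dg := leaf_proj_derivable (hyp3_leaf_curve p'phi2).
have small' : small_patches (iter n (rational_fun P Q) \o g) r delta.
  rewrite -fE (_ : iter n f \o g = @ext_proj R f E \o psi) //.
  by apply/funext => u; rewrite -psiE /g /= ext_iter_semiconj.
have z1R : cmod (mu * z1) <= R1 by rewrite cmodM mu1 mul1r /R1 lerDl.
have := Hn0 n g nn dg small' _ z1R.
apply/negP; rewrite -leNgt; apply: sep.
  by have := H0 0; rewrite subrr cmod0 E0 /= mulr0; apply.
by have := H1 z1; rewrite subrr cmod0 E1 /=; apply.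
Qed.

Lemma flow_time_bounded (p q : hyp3 E) : exists U V (b : R),
  [/\ nbhs p U, nbhs q V & forall r p', U p' -> V (vertical_flow r p') -> r <= b].
Proof.
have [phi _ pphi] := hyp3_inhabited p.
have [psi _ qpsi] := hyp3_inhabited q.
have [u1 u1N] : exists u1, phi u1 <> psi 0.
  have [z1 z1N] := hyp3_nonconstant pphi.
  have [H|] := pselect (phi 0 = psi 0); last by exists 0.
  by exists z1; rewrite -H => H'; apply: z1N; rewrite H'.
have [N1 [N0 [nN1 nN0 sep]]] := lam_separated u1N.
have [e1 e10 nU] := hyp3_value_nbhs pphi nN1.
have [e0 e00 nV] := hyp3_value_nbhs qpsi nN0.
eexists; eexists; exists (cmod u1 / e0); split; [exact: nU|exact: nV|].
move=> r p' [phi1 p'phi1 H1] [psi0 /= [phi2 p'phi2 <-] H0].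
have [la la1 E1] := hyp3_rotation p'phi2 p'phi1.
have er0 : 0 < expR r :> R by rewrite expR_gt0.
have rle : r <= expR r by have := expR_ge1Dx r; lra.
apply: le_trans rle _; rewrite leNgt; apply/negP => lt_e.
apply: (sep (phi1 u1)); first by apply: H1; rewrite subrr cmod0.
have -> : phi1 u1 = (phi2 \o *%R ((expR r)%:C : C)) ((expR r)%:C^-1 * (la * u1)).
  by rewrite E1 /= mulVKf // fmorph_eq0 gt_eqF.
apply: H0; rewrite subr0 !cmodM cmodV cmodR gtr0_norm // la1 mul1r.
rewrite mulrC ltr_pdivrMr // mulrC.
by rewrite ltr_pdivrMr // in lt_e.
Qed.

Lemma iter_ext_invK m : cancel (iter m (@ext_inv R f E)) (iter m (@ext_map R f E)).
Proof. by elim: m => // m IH x; rewrite iterSr iterS ext_invK IH. Qed.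

Lemma induced_actK n (X : set (C -> E)) :
  induced_act E (Posz n.+1) (induced_act E (Negz n) X) = X.
Proof.
have K phi : ext_iter (Posz n.+1) \o (ext_iter (Negz n) \o phi) = phi.
  by apply/funext => u; exact: (iter_ext_invK n.+1).
apply/seteqP; split=> [_ [_ [phi Xphi <-] <-]|phi Xphi]; first by rewrite K.
by exists (ext_iter (Negz n) \o phi); [exists phi|exact: K].
Qed.

Lemma vertical_flowK r (p : hyp3 E) : vertical_flow (- r) (vertical_flow r p) = p.
Proof.
apply: eq_sig_hprop => /=; first by move=> X; exact: Prop_irrelevance.
case: p => X HX /=.
have K (phi : C -> E) :
    (phi \o *%R ((expR r)%:C : C)) \o *%R ((expR (- r))%:C : C) = phi.
  apply/funext => u /=; rewrite mulrA -rmorphM -expRD subrr expR0.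
  by rewrite rmorph1 mul1r.
apply/seteqP; split=> [_ [_ [phi Xphi <-] <-]|phi Xphi]; first by rewrite K.
by exists (phi \o *%R ((expR r)%:C : C)); [exists phi|exact: K].
Qed.

End Dynamics.

Local Close Scope ring_scope.
Local Close Scope complex_scope.

Theorem proposition6p2 (R : realType) (d : nat) (f : sphere R -> sphere R)
    (hd : 2 <= d) (hf : rational_map d f) (E : affine_extension f) :
  (forall p q : hyp3 E, exists (U V : set (hyp3 E)),
     [/\ nbhs p U, nbhs q V &
         finite_set [set n : int |
           (induced_act E n @` (sval @` U)) `&` (sval @` V) !=set0]]) /\
  (forall p q : hyp3 E, exists (U V : set (hyp3 E)),
     [/\ nbhs p U, nbhs q V &
         compact (closure [set r : R |
           (vertical_flow r @` U) `&` V !=set0])]).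
Proof.
split=> p q.
  have [U1 [V1 [nU1 nV1 [n1 H1]]]] := forward_wandering p q hd hf.
  have [U2 [V2 [nU2 nV2 [n2 H2]]]] := forward_wandering q p hd hf.
  exists (U1 `&` V2), (V1 `&` U2); split; [exact: filterI|exact: filterI|].
  apply: (@sub_finite_set _ _ ((Posz @` `I_n1) `|` (Negz @` `I_n2))); last first.
    by rewrite finite_setU; split; apply: finite_image; exact: finite_II.
  case=> n [X [[_ [p' [U1p' V2p'] <-] <-] [q' [V1q' U2q'] E']]].
    left; exists n => //=; rewrite ltnNge; apply/negP => nn.
    exact: (H1 n p' q' nn U1p' V1q' (esym E')).
  (* a negative iterate from [p] to [q] is a positive one from [q] to [p] *)
  right; exists n => //=; rewrite ltnNge; apply/negP => nn.
  apply: (H2 n.+1 q' p' (leqW nn) U2q' V2p').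
  by rewrite E' induced_actK.
have [U1 [V1 [b1 [nU1 nV1 H1]]]] := flow_time_bounded p q.
have [U2 [V2 [b2 [nU2 nV2 H2]]]] := flow_time_bounded q p.
exists (U1 `&` V2), (V1 `&` U2); split; [exact: filterI|exact: filterI|].
apply: (@subclosed_compact _ _ `[(- b2)%R, b1]); [exact: closed_closure|exact: segment_compact|].
have /closure_id -> : closed `[(- b2)%R, b1] by exact: interval_closed.
apply: closure_subset => r [q' [[p' [U1p' V2p'] <-] [V1q' U2q']]].
have rb1 : (r <= b1)%R := H1 r p' U1p' V1q'.
have rb2 : (- r <= b2)%R by apply: (H2 _ (vertical_flow r p')) => //; rewrite vertical_flowK.
by rewrite /= in_itv /= lerNl rb2 rb1.
Qed.
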